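(* Let $(X,\mathcal{X},\mu)$ be a probability space, let $T_1,\ldots,T_\ell\colon X\to X$ be commuting, invertible measure preserving transformations, and let $f_1,\ldots,f_\ell\in L^\infty(\mu)$. Suppose that the polynomials $p_1,\ldots,p_\ell\in\mathbb{Z}[t]$ have distinct degrees. Then the limit $$\lim_{N-M\to\infty}\frac{1}{N-M}\sum_{n=M}^{N-1} f_1(T_1^{p_1(n)}x)\cdot\ldots\cdot f_\ell(T_\ell^{p_\ell(n)}x)$$ exists in $L^2(\mu)$.
   Context: All functions are real valued. $\lim_{N-M\to\infty}\frac{1}{N-M}\sum_{n=M}^{N-1}a_n=L$ means that the averages of $(a_n)_{n\in\mathbb{N}}$ over any sequence of intervals in $\mathbb{N}=\{1,2,\ldots\}$ whose lengths tend to infinity converge to the same limit $L$ (here in $L^2(\mu)$). *)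

(* Defs.v *)
From HB Require Import structures.
From mathcomp Require Import all_boot all_order all_algebra.
From mathcomp Require Import all_classical all_reals all_analysis.

Set Implicit Arguments.
Unset Strict Implicit.
Unset Printing Implicit Defensive.

Import Order.TTheory GRing.Theory Num.Theory.
Import numFieldNormedType.Exports.

Local Open Scope classical_set_scope.
Local Open Scope ring_scope.

Definition measure_preserving (d : measure_display) (X : measurableType d)
    (R : realType) (mu : probability X R) (T : X -> X) : Prop :=
  measurable_fun [set: X] T /\
  forall A : set X, measurable A -> mu (T @^-1` A) = mu A.

(* The inverse need only be assumed measurable: it then preserves mu too. *)
Record invertible_mp (d : measure_display) (X : measurableType d)
    (R : realType) (mu : probability X R) := InvertibleMP {
  mp_fun :> X -> X;
  mp_inv : X -> X;
  mp_funK : cancel mp_fun mp_inv;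
  mp_invK : cancel mp_inv mp_fun;
  mp_fun_preserving : measure_preserving mu mp_fun;
  mp_inv_measurable : measurable_fun [set: X] mp_inv
}.

(* T^m for an integer m; Negz k stands for -(k+1). *)
Definition iterz (d : measure_display) (X : measurableType d)
    (R : realType) (mu : probability X R) (T : invertible_mp mu) (m : int)
    (x : X) : X :=
  match m with
  | Posz k => iter k T x
  | Negz k => iter k.+1 (mp_inv T) x
  end.

Definition interval_average (X : Type) (R : realType) (a : nat -> X -> R)
    (M N : nat) (x : X) : R :=
  ((N - M)%N%:R)^-1 * \sum_(M <= n < N) a n x.

(* lim_{N-M -> oo} 1/(N-M) sum_{n=M}^{N-1} a_n = L in L^2(mu). Indices start
   at 1; as the subtraction is truncated, the hypothesis that N k - M k tends
   to infinity forces M k < N k for all large k. *)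
Definition uniform_average_cvg_L2 (d : measure_display) (X : measurableType d)
    (R : realType) (mu : probability X R) (a : nat -> X -> R) (L : X -> R) :
    Prop :=
  forall M N : nat -> nat,
    (forall k, (0 < M k)%N) ->
    (N k - M k)%N @[k --> \oo] --> \oo ->
    Lnorm mu 2%:E (EFin \o (interval_average a (M k) (N k) \- L))
      @[k --> \oo] --> (0 : \bar R).

(* Main.v *)
(** The proof follows Walsh (Norm convergence of nilpotent ergodic averages), in
    the commutative case. The powers of the [T i] form an action of [Z^l], and an
    average is given by a list of sequences [g : nat -> Z^l] with functions. By an
    energy increment argument, the last function of the list splits into a sum of
    dual functions, on which the average becomes a mean over [m] of averages of the
    reduced lists [R ++ map (twin s m) (0 :: R)], and a remainder with small
    averages. Polynomial lists become trivial after finitely many reductions. As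
    the number of reduced lists is unbounded, the induction does not go through
    with convergence; it is carried out with metastability, uniformly in finite
    families of systems: at some scale [M] below a fixed bound, the averages over
    intervals of length at least [M] contained in [[0, F M)] are close to each
    other. For arbitrary [F] this implies that the averages are uniformly Cauchy in
    [L^2]. *)

Require Import Defs.
From HB Require Import structures.
From mathcomp Require Import all_boot all_order all_algebra.
From mathcomp Require Import all_classical all_reals all_analysis.
From mathcomp Require Import measurable_realfun ess_sup_inf.
From mathcomp Require Import ring lra zify.

Import Order.TTheory GRing.Theory Num.Theory.
Import numFieldNormedType.Exports.

Local Open Scope classical_set_scope.
Local Open Scope ring_scope.

Set Implicit Arguments.
Unset Strict Implicit.
Unset Printing Implicit Defensive.

(** * Complexity *)

Section Complexity.
Variable A : zmodType.
Implicit Types (g h s x : nat -> A) (S : seq (nat -> A)) (J : (nat -> A) -> Prop).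

(** Displacement of the factor of a dual function that runs along [g]: it is taken at time [n + m],
    moved back by [s (n + m)] and then read along [s n]. *)
Definition twin s (m : nat) g : nat -> A := fun n => s n - s (n + m)%N + g (n + m)%N.

(* The sequence [0] put in front of [R] carries the average itself, which is one
   of the factors of a dual function. *)
Fixpoint complexity (k : nat) S : Prop :=
  if k is k'.+1 then
    exists s R, {subset S <= s :: R} /\
      forall m, complexity k' (R ++ map (twin s m) (0 :: R))
  else {in S, forall g, g = 0}.

(** Polynomial sequences through vanishing iterated differences, which makes sense in any abelian
    group. [degree_lt 0] holds of [0] only, [degree_lt 1] of the constants. *)
Fixpoint degree_lt (k : nat) g : Prop :=
  if k is k'.+1 then forall m, degree_lt k' (fun n => g (n + m)%N - g n) else g = 0.

Lemma degree_lt0 k : degree_lt k 0.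
Proof.
elim: k => //= k IH m; suff -> : (fun n => (0 : nat -> A) (n + m)%N - (0 : nat -> A) n) = 0 by [].
by apply/funext => n /=; rewrite subrr.
Qed.

Lemma degree_ltS k g : degree_lt k g -> degree_lt k.+1 g.
Proof.
elim: k g => [g -> m|k IH g gk m]; first exact: degree_lt0 1 m.
exact: IH (gk m).
Qed.

Lemma degree_ltD k g h : degree_lt k g -> degree_lt k h -> degree_lt k (g + h).
Proof.
elim: k g h => /= [g h -> ->|k IH g h gk hk m]; first by rewrite addr0.
have -> : (fun n => (g + h) (n + m)%N - (g + h) n) =
  (fun n => g (n + m)%N - g n) + (fun n => h (n + m)%N - h n).
  by apply/funext => n; rewrite !fctE opprD addrACA.
exact: IH.
Qed.

Lemma degree_ltN k g : degree_lt k g -> degree_lt k (- g).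
Proof.
elim: k g => /= [g ->|k IH g gk m]; first by rewrite oppr0.
have -> : (fun n => (- g) (n + m)%N - (- g) n) = - (fun n => g (n + m)%N - g n).
  by apply/funext => n; rewrite !fctE opprD.
exact: IH.
Qed.

Lemma degree_lt_shift k m g : degree_lt k g -> degree_lt k (fun n => g (n + m)%N).
Proof.
elim: k g => /= [g ->//|k IH g gk m'].
have -> : (fun n => g (n + m' + m)%N - g (n + m)%N) =
  (fun n => (fun n => g (n + m')%N - g n) (n + m)%N).
  by apply/funext => n; rewrite addnAC.
exact: (IH (fun n => g (n + m')%N - g n)).
Qed.

Lemma degree_ltBC k g h : degree_lt k (g - h) -> degree_lt k (h - g).
Proof. by move=> /degree_ltN; rewrite opprB. Qed.

Lemma degree_lt_trans k g h s :
  degree_lt k (g - h) -> degree_lt k (h - s) -> degree_lt k (g - s).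
Proof. by move=> gh /(degree_ltD gh); rewrite addrA subrK. Qed.

(* [twin s m x - x] is the [m]-th difference of [x - s]. *)
Lemma degree_lt_twin k s m x : degree_lt k.+1 (x - s) -> degree_lt k (twin s m x - x).
Proof.
move=> /(_ m); congr degree_lt; apply/funext => n; rewrite !fctE /twin opprB.
by rewrite addrC addrACA -[RHS]addrA [- _ + _]addrC.
Qed.

Definition twin_closed (k : nat) s0 J : Prop :=
  J 0 /\ forall s x m, degree_lt k (s - s0) -> J x -> J (twin s m x).

(** The bound depends on the length of the list alone, because the reductions of a list for all [m]
    must share one complexity. *)
Definition complexity_bounded (kap : nat -> nat) J : Prop :=
  forall S, {in S, forall x, J x} -> complexity (kap (size S)) S.

(* Reductions that remove the sequences at distance of degree [< k] from [s0] only
   add twins of the other sequences, and these stay in [J]. *)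
Definition cluster_removal (k : nat) (kap kap' : nat -> nat) : Prop :=
  forall s0 J, twin_closed k s0 J -> complexity_bounded kap J ->
    complexity_bounded kap' (fun x => J x \/ degree_lt k (x - s0)).

(** In the inductive step, a twin moves a sequence within degree [< k.+1] of [s0] by a sequence of
    degree [< k] only. Hence the sequences near [s0] fall into at most [size S] clusters of diameter
    [< k], which are removed one after another while the clusters still waiting keep their
    centres. *)
Lemma cluster_removalP k kap : exists kap', cluster_removal k kap kap'.
Proof.
elim: k kap => [|k IHk] kap.
  (* One reduction, after which a list of length [r] has length [r + r.+1]. *)
  exists (fun r => (kap (r + r.+1)%N).+1) => s0 J [J0 Jt] bJ S SJ /=.
  (* The sequences to remove equal [s0], which becomes the head. In their places stands [0], a
     member of [J], so that the length is kept. *)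
  exists s0, [seq if x == s0 then 0 else x | x <- S]; set R := map _ S.
  have RJ : {in R, forall x, J x}.
    move=> _ /mapP[x xS ->]; case: eqP => // xs0.
    by case: (SJ _ xS) => // /eqP; rewrite subr_eq0 => /eqP.
  split=> [x xS|m].
    rewrite in_cons; case: eqP => //= xs0; apply/mapP; exists x => //.
    by case: eqP.
  have -> : (size S + (size S).+1)%N = size (R ++ map (twin s0 m) (0 :: R)).
    by rewrite size_cat /= !size_map.
  apply: bJ => x; rewrite mem_cat => /orP[/RJ//|/mapP[y yR ->]].
  apply: Jt; first by rewrite subrr.
  by move: yR; rewrite in_cons => /orP[/eqP->//|/RJ].
have [Phi PhiP] := choice IHk.
exists (fun r => iter r Phi kap r) => s0 J [J0 Jt] bJ S SJ.
(* The centres are the sequences of [S] near [s0] themselves. Padding with [s0] makes their number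
   exactly [size S]. *)
pose q := [seq if `[< degree_lt k.+1 (x - s0) >] then x else s0 | x <- S].
have s00 : degree_lt k.+1 (s0 - s0) by rewrite subrr; exact: degree_lt0.
have qs0 : {in q, forall x, degree_lt k.+1 (x - s0)}.
  by move=> _ /mapP[x xS ->]; case: ifPn => // /asboolP.
suff H : complexity_bounded (iter (size q) Phi kap)
    (fun x => J x \/ exists2 y, y \in q & degree_lt k (x - y)).
  rewrite -[X in iter X](size_map (fun x => if `[< degree_lt k.+1 (x - s0) >] then x else s0)).
  apply: H => x xS; have [Jx|xs0] := SJ _ xS; [by left|right].
  exists x; last by rewrite subrr; exact: degree_lt0.
  by apply/mapP; exists x => //; case: ifPn => // /asboolP.
elim: q qs0 {SJ} => [|y q IHq] qs0 /=.
  by move=> S' S'J; apply: bJ => x /S'J[//|[]].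
have {}IHq := IHq (fun x xq => qs0 x (@mem_behead _ (y :: q) x xq)).
have ys0 := qs0 _ (mem_head _ _).
(* Here [s] is close to [y], so [s] and [x] both lie within degree [< k.+1] of [s0]; the twin of [x]
   therefore stays in the cluster of [z]. *)
have cl : twin_closed k y (fun x => J x \/ exists2 y, y \in q & degree_lt k (x - y)).
  split=> [|s x m sy]; first by left.
  have ss0 : degree_lt k.+1 (s - s0) by apply: degree_lt_trans ys0; exact: degree_ltS.
  case=> [Jx|[z zq xz]]; [by left; exact: Jt|right].
  exists z => //; apply: degree_lt_trans (xz); apply: degree_lt_twin.
  apply: degree_lt_trans (degree_ltBC ss0).
  by apply: (degree_lt_trans (degree_ltS xz)); apply: qs0; rewrite in_cons zq orbT.
move=> S' S'J; apply: (PhiP _ _ _ cl IHq) => x /S'J[Jx|[z]]; first by left; left.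
rewrite in_cons => /orP[/eqP->|zq] xz; first by right.
by left; right; exists z.
Qed.

(** The sequences of degree [< k.+1] are those near [s0 = 0]. Removing them leaves the class of
    degree [< k], which is closed under twins with such [s]. *)
Lemma complexity_bounded_degree k : exists kap, complexity_bounded kap (degree_lt k).
Proof.
elim: k => [|k [kap bk]]; first by exists (fun=> 0%N) => S SJ x /SJ.
have [kap' H] := cluster_removalP k.+1 kap; exists kap' => S SJ.
apply: (H 0 (degree_lt k)) => // [|x /SJ ?]; last by right; rewrite subr0.
split=> [|s x m]; first exact: degree_lt0.
rewrite subr0 => sk xk; rewrite -[twin _ _ _](subrK x); apply: degree_ltD => //.
by apply: degree_lt_twin; apply: degree_ltD; [exact: degree_ltS|exact: degree_ltN].
Qed.

End Complexity.

(** * Averages over intervals *)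

Section IntervalAverage.
Variables (X : Type) (R : realType).
Implicit Types (f g : nat -> X -> R) (a b : nat) (x : X).

Lemma interval_averageD f g a b x :
  interval_average (fun n x => f n x + g n x) a b x =
  interval_average f a b x + interval_average g a b x.
Proof. by rewrite /interval_average big_split mulrDr. Qed.

Lemma interval_averageZ c f a b x :
  interval_average (fun n x => c * f n x) a b x = c * interval_average f a b x.
Proof. by rewrite /interval_average -mulr_sumr mulrCA. Qed.

Lemma interval_average_sum (N : nat) (F : nat -> nat -> X -> R) a b x :
  interval_average (fun n x => \sum_(0 <= i < N) F i n x) a b x =
  \sum_(0 <= i < N) interval_average (F i) a b x.
Proof. by rewrite /interval_average exchange_big mulr_sumr. Qed.

Lemma eq_interval_average f g a b x :
  (forall n, (a <= n < b)%N -> f n x = g n x) ->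
  interval_average f a b x = interval_average g a b x.
Proof. by move=> fg; rewrite /interval_average; congr (_ * _); apply: eq_big_nat. Qed.

Lemma interval_average_norm_le (C : R) f a b x : 0 <= C ->
  (forall n, (a <= n < b)%N -> `|f n x| <= C) -> `|interval_average f a b x| <= C.
Proof.
move=> C0 fC; have [ab|ba] := ltnP a b; last first.
  by rewrite /interval_average big_geq // mulr0 normr0.
have N0 : 0 < (b - a)%N%:R :> R by rewrite ltr0n subn_gt0.
rewrite /interval_average normrM ger0_norm ?invr_ge0 ?ler0n // ler_pdivrMl //.
apply: (le_trans (ler_norm_sum _ _ _)).
apply: (@le_trans _ _ (\sum_(a <= n < b) C)).
  by rewrite big_nat [leRHS]big_nat; apply: ler_sum => n; exact: fC.
by rewrite sumr_const_nat -[C *+ _]mulr_natl lexx.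
Qed.

Lemma interval_average_cst (c : R) a b x : (a < b)%N ->
  interval_average (fun _ _ => c) a b x = c.
Proof.
move=> ab; rewrite /interval_average sumr_const_nat -[c *+ _]mulr_natl mulrA mulVf ?mul1r //.
by rewrite pnatr_eq0 -lt0n subn_gt0.
Qed.

End IntervalAverage.

(** * Inequalities for sums and the energy budget *)

Section RealSums.
Variable R : realType.

(** Weighted Cauchy-Schwarz. A new term adds to the difference of the two sides [c N] times a
    quadratic in [d N], whose discriminant is nonpositive by the induction hypothesis. *)
Lemma sqr_sum_le (N : nat) (c d : nat -> R) : (forall i, 0 <= c i) ->
  (\sum_(0 <= i < N) c i * d i) ^+ 2 <=
  (\sum_(0 <= i < N) c i) * \sum_(0 <= i < N) c i * d i ^+ 2.
Proof.
move=> c0; elim: N => [|N IH]; first by rewrite !big_geq // mulr0 expr0n.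
rewrite !big_nat_recr //=.
have : 0 <= \sum_(0 <= i < N) c i by apply: sumr_ge0.
have : 0 <= \sum_(0 <= i < N) c i * d i ^+ 2.
  by apply: sumr_ge0 => i _; rewrite mulr_ge0 ?sqr_ge0.
move: IH (c0 N); move: (\sum_(0 <= i < N) c i) => C.
move: (\sum_(0 <= i < N) c i * d i) (\sum_(0 <= i < N) c i * d i ^+ 2) => S Q.
move=> SCQ cN Q0 C0.
have H : 0 <= C * d N ^+ 2 - 2 * S * d N + Q.
  have [C00|C1] := eqVneq C 0.
    have -> : S = 0 by apply/eqP; rewrite -sqrf_eq0 eq_le sqr_ge0 andbT (le_trans SCQ) ?C00 ?mul0r.
    by rewrite C00 mul0r mulr0 mul0r subrr add0r.
  have Cp : 0 < C by rewrite lt_def C1.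
  rewrite -(pmulr_rge0 _ Cp).
  have -> : C * (C * d N ^+ 2 - 2 * S * d N + Q) = (C * d N - S) ^+ 2 + (C * Q - S ^+ 2) by ring.
  by rewrite addr_ge0 ?sqr_ge0 ?subr_ge0.
have {}H : 0 <= c N * (C * d N ^+ 2 - 2 * S * d N + Q) by rewrite mulr_ge0.
rewrite -subr_ge0.
have -> : (C + c N) * (Q + c N * d N ^+ 2) - (S + c N * d N) ^+ 2 =
  (C * Q - S ^+ 2) + c N * (C * d N ^+ 2 - 2 * S * d N + Q) by ring.
by rewrite addr_ge0 ?subr_ge0.
Qed.

(** Each unit shift trades the term at one end for a term at the other. *)
Lemma norm_sum_shift_le (G : nat -> R) (a b n : nat) : (a <= b)%N ->
  (forall i, `|G i| <= 1) ->
  `|\sum_(a <= i < b) G i - \sum_(a <= i < b) G (n + i)%N| <= 2 * n%:R.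
Proof.
move=> ab G1; elim: n => [|n IH].
  by rewrite mulr0 (_ : _ - _ = 0) ?normr0 // subrr.
have -> : \sum_(a <= i < b) G (n.+1 + i)%N =
    \sum_(a <= i < b) G (n + i)%N + (G (n + b)%N - G (n + a)%N).
  rewrite [RHS]addrC -(telescope_sumr (fun i => G (n + i)%N) ab) -big_split /=.
  by apply: eq_bigr => i _; rewrite addnS addSn subrK.
have := G1 (n + b)%N; have := G1 (n + a)%N.
move: IH; rewrite !ler_norml -natr1; lra.
Qed.

Section Energy.
Variable e : R.
Hypothesis e0 : 0 < e.

(** Bound on the remainder after [j] energy drops: each drop subtracts [e / B] times a dual function
    bounded by [1], where [B] is the current bound. *)
Definition sup_bound (j : nat) : R := iter j (fun B => B + e / B) 1.

Lemma sup_bound_ge1 j : 1 <= sup_bound j.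
Proof.
elim: j => [|j IH] //=; rewrite (le_trans IH) // lerDl divr_ge0 ?(ltW e0) //.
exact: le_trans IH.
Qed.

Lemma sup_bound_gt0 j : 0 < sup_bound j.
Proof. exact: lt_le_trans (sup_bound_ge1 j). Qed.

Lemma sqr_sup_bound j :
  sup_bound j ^+ 2 = 1 + 2 * e * j%:R + \sum_(0 <= i < j) (e / sup_bound i) ^+ 2.
Proof.
elim: j => [|j IH]; first by rewrite big_geq // mulr0 !addr0 expr1n.
rewrite big_nat_recr //= -/(sup_bound j) addrA -natr1.
have -> : (sup_bound j + e / sup_bound j) ^+ 2 =
   sup_bound j ^+ 2 + 2 * e + (e / sup_bound j) ^+ 2.
  by field; rewrite gt_eqF // sup_bound_gt0.
by rewrite IH; ring.
Qed.

(* If the energy drops were summable, [sup_bound j ^+ 2] would grow at most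
   linearly, and the drops would dominate a harmonic series. *)
Lemma energy_unbounded : exists K, 1 < \sum_(0 <= j < K) (e / sup_bound j) ^+ 2.
Proof.
apply: contrapT => /forallNP H.
have {}H K : \sum_(0 <= j < K) (e / sup_bound j) ^+ 2 <= 1 by rewrite leNgt; apply/negP/H.
(* If all drops sum to at most [1], then [sup_bound j ^+ 2 <= C * j.+1%:R]. *)
pose C := 2 + 2 * e.
have C0 : 0 < C by rewrite addr_gt0 ?mulr_gt0.
apply: (@dvg_harmonic R); apply: nondecreasing_is_cvgn.
  by apply: nondecreasing_series => n _ _ /=; rewrite invr_ge0.
exists (C / e ^+ 2) => _ [K _ <-].
rewrite ler_pdivlMr ?exprn_gt0 // -[leRHS]mulr1 -ler_pdivrMl // (le_trans _ (H K)) //.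
rewrite /series /= mulr_suml mulr_sumr; apply: ler_sum => j _.
rewrite /harmonic /= exprMn mulrA mulrC; apply: ler_wpM2l; first exact: sqr_ge0.
rewrite -invfM exprVn lef_pV2 ?posrE ?mulr_gt0 ?exprn_gt0 ?sup_bound_gt0 //.
rewrite sqr_sup_bound; have := H j; have : 0 <= j%:R :> R by [].
by move: e0; rewrite /C -natr1; nra.
Qed.

End Energy.
End RealSums.

(** * Energy decrease *)

(** All that the energy argument uses of a measure preserving action: an invariant algebra of
    observables with an invariant, normalized, monotone linear functional. Measure theory enters
    through the instance [zdynamics]. *)
Record dynamics (R : realType) (A : zmodType) (X : Type) := Dynamics {
  act : A -> X -> X;
  obs : (X -> R) -> Prop;
  mean : (X -> R) -> R;
  act0 : forall x, act 0 x = x;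
  actD : forall a b x, act (a + b) x = act a (act b x);
  obs_cst : forall c, obs (fun=> c);
  obsD : forall f g, obs f -> obs g -> obs (fun x => f x + g x);
  obsM : forall f g, obs f -> obs g -> obs (fun x => f x * g x);
  obs_act : forall a f, obs f -> obs (fun x => f (act a x));
  mean1 : mean (fun=> 1) = 1;
  meanD : forall f g, obs f -> obs g -> mean (fun x => f x + g x) = mean f + mean g;
  meanZ : forall c f, obs f -> mean (fun x => c * f x) = c * mean f;
  mean_le : forall f g, obs f -> obs g -> (forall x, f x <= g x) -> mean f <= mean g;
  mean_act : forall a f, obs f -> mean (fun x => f (act a x)) = mean f }.

Section Dynamics.
Variables (R : realType) (A : zmodType) (X : Type) (D : dynamics R A X).
Implicit Types (f g : X -> R) (S : seq ((nat -> A) * (X -> R))).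
Local Notation act := (act D).
Local Notation obs := (obs D).
Local Notation mean := (mean D).

Lemma actNK a x : act (- a) (act a x) = x.
Proof. by rewrite -actD addNr act0. Qed.

Lemma obsZ c f : obs f -> obs (fun x => c * f x).
Proof. exact/obsM/obs_cst. Qed.

Lemma obsB f g : obs f -> obs g -> obs (fun x => f x - g x).
Proof.
move=> of_ og; have := obsD of_ (obsZ (-1) og).
by congr obs; apply/funext => x; rewrite mulN1r.
Qed.

Lemma obsX2 f : obs f -> obs (fun x => f x ^+ 2).
Proof. by move=> fo; apply: obsM. Qed.

Lemma obs_sum (I : Type) (r : seq I) (F : I -> X -> R) :
  (forall i, obs (F i)) -> obs (fun x => \sum_(i <- r) F i x).
Proof.
move=> oF; elim: r => [|i r IH].
  by under eq_fun do rewrite big_nil; exact: obs_cst.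
by under eq_fun do rewrite big_cons; exact: obsD.
Qed.

Lemma obs_interval_average (F : nat -> X -> R) a b :
  (forall n, obs (F n)) -> obs (interval_average F a b).
Proof. by move=> oF; apply/obsZ/obs_sum. Qed.

Lemma mean_sum (I : Type) (r : seq I) (F : I -> X -> R) :
  (forall i, obs (F i)) ->
  mean (fun x => \sum_(i <- r) F i x) = \sum_(i <- r) mean (F i).
Proof.
move=> oF; elim: r => [|i r IH].
  rewrite big_nil; under eq_fun do rewrite big_nil.
  by have := meanZ 0 (obs_cst D 0); rewrite !mul0r.
rewrite big_cons -IH -meanD //; last exact: obs_sum.
by congr mean; apply/funext => x; rewrite big_cons.
Qed.

Definition unit_obs f := obs f /\ forall x, `|f x| <= 1.

Lemma unit_obsM f g : unit_obs f -> unit_obs g -> unit_obs (fun x => f x * g x).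
Proof.
move=> [of_ f1] [og g1]; split=> [|x]; first exact: obsM.
by rewrite normrM mulr_ile1.
Qed.

Lemma unit_obs_act a f : unit_obs f -> unit_obs (fun x => f (act a x)).
Proof. by move=> [of_ f1]; split=> //; exact: obs_act. Qed.

Lemma unit_obs1 : unit_obs (fun=> 1).
Proof. by split=> [|x]; [exact: obs_cst|rewrite normr1]. Qed.

Definition orbit_prod S (n : nat) (x : X) : R := \prod_(p <- S) p.2 (act (p.1 n) x).

Definition unit_sys S := {in S, forall p, unit_obs p.2}.

Lemma unit_sys_cons p S : unit_sys (p :: S) <-> unit_obs p.2 /\ unit_sys S.
Proof.
split=> [H|[p1 S1] q]; last by rewrite in_cons => /orP[/eqP->|/S1].
by split=> [|q qS]; apply: H; rewrite in_cons ?eqxx // qS orbT.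
Qed.

Lemma unit_sys_cat S S' : unit_sys S -> unit_sys S' -> unit_sys (S ++ S').
Proof. by move=> H H' p; rewrite mem_cat => /orP[/H|/H']. Qed.

Lemma orbit_prod_cons p S n x :
  orbit_prod (p :: S) n x = p.2 (act (p.1 n) x) * orbit_prod S n x.
Proof. by rewrite /orbit_prod big_cons. Qed.

Lemma unit_obs_orbit_prod S n : unit_sys S -> unit_obs (orbit_prod S n).
Proof.
elim: S => [_|p S IH /unit_sys_cons[p1 /IH S1]].
  by have -> : orbit_prod [::] n = fun=> 1;
    [apply/funext => x; rewrite /orbit_prod big_nil|exact: unit_obs1].
have -> : orbit_prod (p :: S) n = fun x => p.2 (act (p.1 n) x) * orbit_prod S n x.
  by apply/funext => x; rewrite orbit_prod_cons.
by apply: unit_obsM => //; exact: unit_obs_act.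
Qed.

Lemma orbit_prod_insert S (g : nat -> A) f : unit_obs f -> unit_sys S -> g \in map fst S ->
  exists S', [/\ map fst S' = map fst S, unit_sys S' &
    forall n x, orbit_prod S' n x = f (act (g n) x) * orbit_prod S n x].
Proof.
move=> f1; elim: S => // -[g' f'] S IH /unit_sys_cons[f'1 S1].
rewrite /= in_cons; have [<- _|gg' /= gS] := eqVneq g g'.
  exists ((g, fun x => f x * f' x) :: S); split=> //=.
    by apply/unit_sys_cons; split=> //; exact: unit_obsM.
  by move=> n x; rewrite !orbit_prod_cons mulrA.
have [S' [S'S S'1 S'E]] := IH S1 gS; exists ((g', f') :: S'); split=> /=.
- by rewrite S'S.
- exact/unit_sys_cons.
- by move=> n x; rewrite !orbit_prod_cons S'E /= mulrCA.
Qed.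

(** Factors along the same sequence merge by multiplication, and sequences of [G] without a factor
    receive the constant [1]. This is why [complexity] asks for an inclusion of lists only. *)
Lemma orbit_prod_absorb S (G : seq (nat -> A)) : unit_sys S ->
  {subset map fst S <= G} ->
  exists S', [/\ map fst S' = G, unit_sys S' &
    forall n x, orbit_prod S' n x = orbit_prod S n x].
Proof.
elim: S => [_ _|[g f] S IH /unit_sys_cons[f1 S1] SG].
  exists [seq (h, fun=> 1) | h <- G]; split.
  - by rewrite -map_comp map_id.
  - by move=> _ /mapP[g _ ->]; exact: unit_obs1.
  - by move=> n x; rewrite /orbit_prod big_map big_nil big1.
have [|S' [S'G S'1 S'E]] := IH S1.
  by move=> g' g'S; apply: SG; rewrite in_cons g'S orbT.
have [|S2 [S2S S21 S2E]] := orbit_prod_insert (g := g) f1 S'1.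
  by rewrite S'G; apply: SG; rewrite mem_head.
exists S2; split=> // [|n x]; first by rewrite S2S.
by rewrite S2E S'E orbit_prod_cons.
Qed.

Section Family.
Variables (Om : Type) (l : seq Om) (w : Om -> R).
Hypothesis w0 : forall o, 0 <= w o.
Hypothesis w1 : \sum_(o <- l) w o <= 1.
Implicit Types u v : Om -> X -> R.

(** Energies are averaged over a weighted family, so that one scale serves all the reduced lists at
    once, however many there are. *)
Definition family_mean v : R := \sum_(o <- l) w o * mean (v o).

Lemma family_meanD u v : (forall o, obs (u o)) -> (forall o, obs (v o)) ->
  family_mean (fun o x => u o x + v o x) = family_mean u + family_mean v.
Proof.
move=> ou ov; rewrite /family_mean -big_split; apply: eq_bigr => o _.
by rewrite meanD // mulrDr.
Qed.

Lemma family_meanZ c u : (forall o, obs (u o)) ->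
  family_mean (fun o x => c * u o x) = c * family_mean u.
Proof.
move=> ou; rewrite /family_mean mulr_sumr; apply: eq_bigr => o _.
by rewrite meanZ // mulrCA.
Qed.

Lemma family_mean_le u v : (forall o, obs (u o)) -> (forall o, obs (v o)) ->
  (forall o x, u o x <= v o x) -> family_mean u <= family_mean v.
Proof.
by move=> ou ov uv; apply: ler_sum => o _; apply: ler_wpM2l => //; exact: mean_le.
Qed.

Lemma eq_family_mean u v : (forall o x, u o x = v o x) -> family_mean u = family_mean v.
Proof. by move=> uv; congr family_mean; apply/funext => o; apply/funext. Qed.

Lemma family_mean_cst_le (c : R) : 0 <= c -> family_mean (fun _ _ => c) <= c.
Proof.
move=> c0; have -> : family_mean (fun _ _ => c) = c * \sum_(o <- l) w o.
  rewrite /family_mean mulr_sumr; apply: eq_bigr => o _; rewrite mulrC; congr (_ * _).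
  by have := meanZ c (obs_cst D 1); rewrite mean1 !mulr1.
by rewrite ler_piMr.
Qed.

Lemma family_mean_ge0 u : (forall o, obs (u o)) -> (forall o x, 0 <= u o x) ->
  0 <= family_mean u.
Proof.
move=> ou u0; apply: (@le_trans _ _ (family_mean (fun _ _ => 0))).
  have := @family_meanZ 0 (fun _ _ => 0) (fun=> obs_cst D 0).
  by rewrite !mul0r => ->.
by apply: family_mean_le => // o; exact: obs_cst.
Qed.

Lemma family_mean_sum (N : nat) (F : nat -> Om -> X -> R) :
  (forall i o, obs (F i o)) ->
  family_mean (fun o x => \sum_(0 <= i < N) F i o x) =
  \sum_(0 <= i < N) family_mean (F i).
Proof.
move=> oF; rewrite /family_mean exchange_big; apply: eq_bigr => o _.
by rewrite mean_sum // mulr_sumr.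
Qed.

Variables (s : Om -> nat -> A) (rest : Om -> seq ((nat -> A) * (X -> R))).
Hypothesis rest1 : forall o, unit_sys (rest o).

Definition head_average u (a b : nat) (o : Om) : X -> R :=
  interval_average
    (fun n x => u o (act (s o n) x) * orbit_prod (rest o) n x) a b.

(** Summand of a dual function. By invariance under [s o m], its pairing with a function [f] is the
    pairing of [u o] with the term [f (act (s o m) x) * orbit_prod (rest o) m x] of an average. *)
Definition pullback u (m : nat) (o : Om) (y : X) : R :=
  u o (act (- s o m) y) * orbit_prod (rest o) m (act (- s o m) y).

Lemma obs_head_average u a b o : (forall o, obs (u o)) -> obs (head_average u a b o).
Proof.
move=> ou; apply: obs_interval_average => n; apply: obsM; first exact: obs_act.
by have [] := unit_obs_orbit_prod n (rest1 (o := o)).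
Qed.

Lemma head_average_norm_le (B : R) u a b o x : (forall x, `|u o x| <= B) ->
  `|head_average u a b o x| <= B.
Proof.
move=> uB; have B0 : 0 <= B by apply: le_trans (uB x).
apply: interval_average_norm_le => // n _; rewrite normrM -[B]mulr1 ler_pM //.
by have [_] := unit_obs_orbit_prod n (rest1 (o := o)); apply.
Qed.

Lemma unit_obs_pullback u m o : unit_obs (u o) -> unit_obs (pullback u m o).
Proof.
move=> u1; apply: unit_obsM; first exact: unit_obs_act.
exact/unit_obs_act/unit_obs_orbit_prod.
Qed.

(** The time is [n + m] and not [m], so that [s] enters through the differences [s n - s (n + m)]
    and its degree goes down. The factor [u] of the pullback runs along the twin of [0]. *)
Lemma orbit_prod_reduction u m n o x :
  pullback u (n + m) o (act (s o n) x) * orbit_prod (rest o) n x =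
  orbit_prod (rest o ++ [seq (twin (s o) m p.1, p.2) | p <- (0, u o) :: rest o]) n x.
Proof.
rewrite [RHS]/orbit_prod big_cat big_map big_cons /= mulrC; congr (_ * _).
rewrite /pullback /orbit_prod -actD /twin addr0 addrC; congr (_ * _).
by apply: eq_bigr => p _; rewrite -actD [in RHS]addrC.
Qed.

Section EnergyDrop.
Variables (u : Om -> X -> R) (a b : nat) (B e : R).
Hypotheses (B0 : 0 < B) (e0 : 0 < e) (ab : (a < b)%N).
Hypotheses (ou : forall o, obs (u o)) (uB : forall o x, `|u o x| <= B).
Hypothesis ue : e <= family_mean (fun o x => head_average u a b o x ^+ 2).

(** Division by [B] brings the average into the unit ball, as it becomes a function of the reduced
    lists. *)
Definition scaled_average (o : Om) (x : X) : R := B^-1 * head_average u a b o x.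

Definition dual_function (o : Om) (y : X) : R :=
  interval_average (fun m y => pullback scaled_average m o y) a b y.

Lemma unit_obs_scaled_average o : unit_obs (scaled_average o).
Proof.
split=> [|x]; first exact/obsZ/obs_head_average.
rewrite normrM normfV (gtr0_norm B0) ler_pdivrMl // mulr1.
exact: head_average_norm_le.
Qed.

Lemma unit_obs_dual_function o : unit_obs (dual_function o).
Proof.
have H m := unit_obs_pullback m (unit_obs_scaled_average o).
split=> [|x]; first by apply: obs_interval_average => m; have [] := H m.
by apply: interval_average_norm_le => // m _; have [_] := H m; apply.
Qed.

(** Invariance under [s o m] turns the [m]-th pairing into that of [scaled_average] with the [m]-th
    term of the average of [u]; summing over [m] gives this average once more, hence its square. *)
Lemma mean_mul_dual_function o :
  mean (fun x => u o x * dual_function o x) =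
  B^-1 * mean (fun x => head_average u a b o x ^+ 2).
Proof.
have op m : obs (pullback scaled_average m o).
  by have [] := unit_obs_pullback m (unit_obs_scaled_average o).
have oP n : obs (orbit_prod (rest o) n).
  by have [] := unit_obs_orbit_prod n (rest1 (o := o)).
have [osa _] := unit_obs_scaled_average o.
transitivity ((b - a)%N%:R^-1 * \sum_(a <= m < b)
    mean (fun x => u o x * pullback scaled_average m o x)).
  rewrite -mean_sum => [|m]; last exact: obsM.
  rewrite -meanZ; last by apply: obs_sum => m; exact: obsM.
  by congr mean; apply/funext => x; rewrite -mulr_sumr mulrCA.
transitivity ((b - a)%N%:R^-1 * \sum_(a <= m < b)
    mean (fun x => scaled_average o x * (u o (act (s o m) x) * orbit_prod (rest o) m x))).
  congr (_ * _); apply: eq_bigr => m _.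
  rewrite -(mean_act (s o m)); last exact: obsM.
  by congr mean; apply/funext => x; rewrite /pullback actNK mulrCA.
rewrite -mean_sum => [|m]; last first.
  by apply: obsM => //; apply: obsM => //; exact: obs_act.
have oh := obs_head_average a b o ou.
rewrite -meanZ; last first.
  by apply: obs_sum => m; apply: obsM => //; apply: obsM => //; exact: obs_act.
rewrite -meanZ; last exact: obsX2.
congr mean; apply/funext => x; by rewrite -mulr_sumr mulrCA expr2 [RHS]mulrA.
Qed.

(** With [c = e / B], the pairing of [u] with the dual function is at least [c] and the dual
    function has energy at most [1]. Expanding the square gives a change of at most
    [- 2 * c ^+ 2 + c ^+ 2]. *)
Lemma energy_drop :
  family_mean (fun o x => (u o x - e / B * dual_function o x) ^+ 2) <=
  family_mean (fun o x => u o x ^+ 2) - (e / B) ^+ 2.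
Proof.
have od o : obs (dual_function o) by have [] := unit_obs_dual_function o.
have -> : family_mean (fun o x => (u o x - e / B * dual_function o x) ^+ 2) =
   family_mean (fun o x => u o x ^+ 2)
   + (- 2 * (e / B)) * family_mean (fun o x => u o x * dual_function o x)
   + (e / B) ^+ 2 * family_mean (fun o x => dual_function o x ^+ 2).
  have ou2 o : obs (fun x => u o x ^+ 2) by exact: obsX2.
  have oud o : obs (fun x => u o x * dual_function o x) by exact: obsM.
  have od2 o : obs (fun x => dual_function o x ^+ 2) by exact: obsX2.
  rewrite -!family_meanZ //.
  rewrite -family_meanD => [|//|o]; last exact: obsZ.
  rewrite -family_meanD => [|o|o]; [|by apply/obsD/obsZ|exact: obsZ].
  by apply: eq_family_mean => o x; ring.
have -> : family_mean (fun o x => u o x * dual_function o x) =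
    B^-1 * family_mean (fun o x => head_average u a b o x ^+ 2).
  rewrite /family_mean mulr_sumr; apply: eq_bigr => o _.
  by rewrite mean_mul_dual_function mulrCA.
have H1 : family_mean (fun o x => dual_function o x ^+ 2) <= 1.
  apply: le_trans (family_mean_cst_le ler01); apply: family_mean_le => [q|q|q x].
  - exact: obsX2.
  - exact: obs_cst.
  - have [_ /(_ x) dx1] := unit_obs_dual_function q.
    by rewrite -(real_normK (num_real (dual_function q x))) exprn_ile1.
have H2 : e / B <= B^-1 * family_mean (fun o x => head_average u a b o x ^+ 2).
  by rewrite mulrC ler_wpM2l // invr_ge0 (ltW B0).
have c0 : 0 < e / B by rewrite divr_gt0.
move: H1 H2 c0; move: (family_mean _) (family_mean _) (_ * family_mean _) (e / B) => p q r c.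
by nra.
Qed.

End EnergyDrop.
End Family.
End Dynamics.

(** * Metastability *)

Section Metastability.
Variables (R : realType) (A : zmodType) (X : Type) (D : dynamics R A X).
Local Notation act := (act D).
Local Notation obs := (obs D).
Local Notation mean := (mean D).
Local Notation sys := (seq ((nat -> A) * (X -> R))).

Definition weights (Om : Type) (l : seq Om) (w : Om -> R) : Prop :=
  (forall o, 0 <= w o) /\ \sum_(o <- l) w o <= 1.

Definition stable_window (Om : Type) (l : seq Om) (w : Om -> R)
    (v : nat -> nat -> Om -> X -> R) (e : R) (M T : nat) : Prop :=
  forall a b a' b', (b <= T)%N -> (b' <= T)%N -> (a + M <= b)%N -> (a' + M <= b')%N ->
    family_mean D l w (fun o x => (v a b o x - v a' b' o x) ^+ 2) <= e.

(* The bound [K] on the scale of stability must not depend on the finite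
   family of systems, only on their complexity. *)
Definition metastable (k : nat) : Prop :=
  forall (e : R) (F : nat -> nat) (M0 : nat), 0 < e -> exists K,
  forall (Om : Type) (l : seq Om) (w : Om -> R) (S : Om -> sys),
    weights l w -> (forall o, complexity k (map fst (S o))) ->
    (forall o, unit_sys D (S o)) ->
    exists2 M, (M0 <= M <= K)%N &
      stable_window l w (fun a b o => interval_average (orbit_prod D (S o)) a b) e M (F M).

Lemma metastable0 : metastable 0.
Proof.
(* The successor excludes empty intervals, whose average is [0] by convention. On the others the
   averages coincide, as all terms are equal. *)
move=> e F M0 e0; exists M0.+1 => Om l w S [w0 w1] S0 S1.
exists M0.+1; first by rewrite leqnSn /=.
move=> a b a' b' _ _ ab a'b'.
have SE o n x : orbit_prod D (S o) n x = orbit_prod D (S o) 0 x.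
  rewrite /orbit_prod big_seq [RHS]big_seq; apply: eq_bigr => p pS.
  by rewrite (S0 o p.1) //; apply/mapP; exists p.
have avE o c d x : (c + M0.+1 <= d)%N ->
    interval_average (orbit_prod D (S o)) c d x = orbit_prod D (S o) 0 x.
  move=> cd; rewrite (@eq_interval_average _ _ _ (fun _ _ => orbit_prod D (S o) 0 x)) //.
  by rewrite interval_average_cst //; lia.
rewrite (@eq_family_mean _ _ _ _ _ _ _ _ (fun _ _ => 0)) => [|o x]; last first.
  by rewrite !avE // subrr expr0n.
exact: le_trans (family_mean_cst_le _ w1 (lexx 0)) (ltW e0).
Qed.

Section Window.
Variables (Om : Type) (l : seq Om) (w : Om -> R).
Variables (s : Om -> nat -> A) (rest : Om -> sys) (h u : Om -> X -> R).
Variables (sz : nat) (c : nat -> R) (m : nat -> nat) (b : nat -> Om -> X -> R).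
Hypotheses (lw : weights l w) (rest1 : forall o, unit_sys D (rest o)).
Hypotheses (c0 : forall i, 0 <= c i) (b1 : forall i o, unit_obs D (b i o)).
Hypothesis ou : forall o, obs (u o).
Hypothesis hE : forall o x,
  h o x = \sum_(0 <= i < sz) c i * pullback D s rest (b i) (m i) o x + u o x.

Definition reduction (o : Om) (m : nat) (f : X -> R) : sys :=
  rest o ++ [seq (twin (s o) m p.1, p.2) | p <- (0, f) :: rest o].

Lemma unit_sys_reduction o m' f : unit_obs D f -> unit_sys D (reduction o m' f).
Proof.
move=> f1; apply: unit_sys_cat => // _ /mapP[p pS ->] /=.
by move: pS; rewrite in_cons => /orP[/eqP->|/rest1].
Qed.

(** Cost of replacing the times [m i] by [n + m i]. It is small because the dual functions are means
    over long intervals of [m]. *)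
Definition shift_error (o : Om) (n : nat) (x : X) : R :=
  \sum_(0 <= i < sz) c i * pullback D s rest (b i) (m i) o (act (s o n) x) -
  \sum_(0 <= i < sz) c i * pullback D s rest (b i) (n + m i) o (act (s o n) x).

Lemma head_average_split a a' o x :
  head_average D s rest h a a' o x =
  \sum_(0 <= i < sz) c i *
     interval_average (orbit_prod D (reduction o (m i) (b i o))) a a' x +
  interval_average (fun n x => shift_error o n x * orbit_prod D (rest o) n x) a a' x +
  head_average D s rest u a a' o x.
Proof.
under eq_bigr do rewrite -interval_averageZ.
rewrite -interval_average_sum /head_average -!interval_averageD; apply: eq_interval_average => n _.
rewrite hE mulrDl; congr (_ + _); rewrite /shift_error mulrBl.
under [X in _ = X + _]eq_bigr do rewrite /reduction -orbit_prod_reduction mulrA.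
by rewrite -mulr_suml addrC subrK.
Qed.

(** By [head_average_split], a difference of averages consists of a difference of reduced averages,
    a difference of two errors of size [del], and two averages of [u]; the leading [4] comes from
    squaring four summands. One factor [C] is due to Cauchy-Schwarz over the coefficients, the other
    to their normalization into weights. *)
Lemma stable_window_step (C del err e' e1 : R) (M T : nat) :
  1 <= C -> \sum_(0 <= i < sz) c i <= C -> 0 <= err -> T%:R * err <= del ->
  (forall o n x, `|shift_error o n x| <= n%:R * err) ->
  stable_window [seq (o, i) | o <- l, i <- index_iota 0 sz]
     (fun oi => w oi.1 * (c oi.2 / C))
     (fun a a' oi => interval_average
        (orbit_prod D (reduction oi.1 (m oi.2) (b oi.2 oi.1))) a a') e' M T ->
  (forall a a', (a' <= T)%N -> (a + M <= a')%N ->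
     family_mean D l w (fun o x => head_average D s rest u a a' o x ^+ 2) <= e1) ->
  stable_window l w (head_average D s rest h)
    (4 * (C ^+ 2 * e' + 4 * del ^+ 2 + 2 * e1)) M T.
Proof.
move=> C1 cC err0 Terr serr red_win u_small a a' d d' a'T d'T aM dM.
have del0 : 0 <= del by apply: le_trans Terr; rewrite mulr_ge0.
have [w0 w1] := lw.
pose Z (i : nat) p q (o : Om) := interval_average (orbit_prod D (reduction o (m i) (b i o))) p q.
pose U p q := head_average D s rest u p q.
have oZ i p q o : obs (Z i p q o).
  apply: obs_interval_average => n.
  by have [] := unit_obs_orbit_prod n (@unit_sys_reduction o (m i) (b i o) (b1 i o)).
have oZ2 i o : obs (fun x => (Z i a a' o x - Z i d d' o x) ^+ 2) by apply/obsX2/obsB.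
have oU p q o : obs (U p q o) by exact: obs_head_average.
have oU2 p q o : obs (fun x => U p q o x ^+ 2) by exact: obsX2.
have oh o : obs (h o).
  rewrite (_ : h o = fun x => \sum_(0 <= i < sz) c i * pullback D s rest (b i) (m i) o x + u o x);
    last by apply/funext => x; rewrite hE.
  apply: obsD => //; apply: obs_sum => i; apply: obsZ.
  by have [] := unit_obs_pullback s rest1 (m i) (b1 i o).
have [E16 E16E] : exists E, E = 16 * del ^+ 2 by exists (16 * del ^+ 2).
have bnd o x : (head_average D s rest h a a' o x - head_average D s rest h d d' o x) ^+ 2 <=
   4 * C * \sum_(0 <= i < sz) c i * (Z i a a' o x - Z i d d' o x) ^+ 2 +
   (E16 + (4 * U a a' o x ^+ 2 + 4 * U d d' o x ^+ 2)).
  rewrite !head_average_split -/(U _ _ _ _) -/(U _ _ _ _).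
  have E1 p q : (q <= T)%N ->
      `|interval_average (fun n x => shift_error o n x * orbit_prod D (rest o) n x) p q x| <= del.
    move=> qT; apply: interval_average_norm_le => // n /andP[_ nq].
    rewrite normrM -[del]mulr1 ler_pM //; last first.
      by have [_] := unit_obs_orbit_prod n (rest1 (o := o)); apply.
    apply: le_trans (serr _ _ _) _; apply: le_trans Terr; apply: ler_wpM2r => //.
    by rewrite ler_nat; lia.
  pose p1 := \sum_(0 <= i < sz) c i * Z i a a' o x.
  pose p2 := \sum_(0 <= i < sz) c i * Z i d d' o x.
  pose q := \sum_(0 <= i < sz) c i * (Z i a a' o x - Z i d d' o x) ^+ 2.
  rewrite -[X in X + _ + _ - _]/p1 -[X in _ - (X + _ + _)]/p2 -/q.
  have psq : (p1 - p2) ^+ 2 <= C * q.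
    rewrite -sumrB; under eq_bigr do rewrite -mulrBr.
    apply: le_trans (sqr_sum_le sz (fun i => Z i a a' o x - Z i d d' o x) c0) _.
    by apply: ler_wpM2r => //; apply: sumr_ge0 => i _; rewrite mulr_ge0 ?sqr_ge0.
  have := E1 a a' a'T; have := E1 d d' d'T; rewrite !ler_norml.
  move: (interval_average _ a a' x) (interval_average _ d d' x) => r1 r2.
  move: (U a a' o x) (U d d' o x) psq => U1 U2 psq /andP[r2l r2u] /andP[r1l r1u].
  have rsq : (r1 - r2) ^+ 2 <= 4 * del ^+ 2 by nra.
  have four (x1 x2 x3 x4 : R) : (x1 + x2 + x3 - x4) ^+ 2 <=
      4 * (x1 ^+ 2 + x2 ^+ 2 + x3 ^+ 2 + x4 ^+ 2).
    rewrite -subr_ge0 (_ : _ - _ = (x1 - x2) ^+ 2 + (x1 - x3) ^+ 2 + (x1 + x4) ^+ 2 +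
      (x2 - x3) ^+ 2 + (x2 + x4) ^+ 2 + (x3 + x4) ^+ 2); last by ring.
    by rewrite !addr_ge0 ?sqr_ge0.
  rewrite (_ : p1 + r1 + U1 - (p2 + r2 + U2) = (p1 - p2) + (r1 - r2) + U1 - U2); last by ring.
  by apply: le_trans (four _ _ _ _) _; rewrite E16E; lra.
have oS o : obs (fun x => \sum_(0 <= i < sz) c i * (Z i a a' o x - Z i d d' o x) ^+ 2).
  by apply: obs_sum => i; exact: obsZ.
apply: le_trans (family_mean_le l w0 _ _ bnd) _ => [om|om|].
- by apply/obsX2/obsB; exact: obs_head_average.
- by apply: obsD; [exact: obsZ|apply: obsD; [exact: obs_cst|apply: obsD; exact: obsZ]].
rewrite family_meanD => [|o|o]; first last.
- by apply: obsD; [exact: obs_cst|apply: obsD; exact: obsZ].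
- exact: obsZ.
rewrite family_meanD => [|o|o]; first last.
- by apply: obsD; exact: obsZ.
- exact: obs_cst.
rewrite family_meanD => [|o|o]; first last.
- exact: obsZ.
- exact: obsZ.
rewrite family_meanZ // family_meanZ // family_meanZ //.
rewrite family_mean_sum => [|i o]; last exact: obsZ.
have Cp : 0 < C by exact: lt_le_trans C1.
(* Divided by [C], the coefficients are weights, and the pairs of a system and an index form a
   single family to which stability applies. *)
have -> : \sum_(0 <= i < sz)
     family_mean D l w (fun o x => c i * (Z i a a' o x - Z i d d' o x) ^+ 2) =
   C * family_mean D [seq (o, i) | o <- l, i <- index_iota 0 sz]
     (fun oi => w oi.1 * (c oi.2 / C))
     (fun oi x => (Z oi.2 a a' oi.1 x - Z oi.2 d d' oi.1 x) ^+ 2).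
  rewrite [in RHS]/family_mean big_allpairs [in RHS]exchange_big /= mulr_sumr.
  apply: eq_bigr => i _; rewrite family_meanZ // /family_mean !mulr_sumr.
  apply: eq_bigr => o _; field.
  by rewrite gt_eqF.
have H1 := red_win a a' d d' a'T d'T aM dM.
have H2 := u_small a a' a'T aM; have H3 := u_small d d' d'T dM.
have H4 : family_mean D l w (fun _ _ => E16) <= 16 * del ^+ 2.
  by rewrite -E16E; apply: family_mean_cst_le => //; rewrite E16E mulr_ge0 ?sqr_ge0.
have H5 : 4 * C * (C * family_mean D [seq (o, i) | o <- l, i <- index_iota 0 sz]
     (fun oi => w oi.1 * (c oi.2 / C))
     (fun oi x => (Z oi.2 a a' oi.1 x - Z oi.2 d d' oi.1 x) ^+ 2)) <= 4 * C ^+ 2 * e'.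
  by rewrite mulrA -[4 * C * C]mulrA -expr2 ler_wpM2l // mulr_ge0 // sqr_ge0.
move: H2 H3 H4 H5; rewrite /U; lra.
Qed.

End Window.
End Metastability.

(** * The energy increment induction *)

Section Descent.
Variables (R : realType) (A : zmodType) (X : Type) (D : dynamics R A X).
Local Notation act := (act D).
Local Notation obs := (obs D).
Local Notation sys := (seq ((nat -> A) * (X -> R))).

Definition step_size (e1 : R) (i : nat) : R := e1 / sup_bound e1 i.

(* [j] is the number of energy drops so far. Shifting the dual functions along
   the orbit by [n], which turns them into averages of reduced systems, costs at
   most [n * err]. *)
Record decomposition (e1 : R) (j : nat) (err : R)
    (Om : Type) (l : seq Om) (w : Om -> R) (s : Om -> nat -> A) (rest : Om -> sys)
    (h u : Om -> X -> R)
    (sz : nat) (c : nat -> R) (m : nat -> nat) (b : nat -> Om -> X -> R) : Prop :=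
  Decomposition {
  dec_c : forall i, 0 <= c i;
  dec_b : forall i o, unit_obs D (b i o);
  dec_sum : \sum_(0 <= i < sz) c i <= \sum_(0 <= i < j) step_size e1 i;
  dec_u : forall o, obs (u o);
  dec_ub : forall o x, `|u o x| <= sup_bound e1 j;
  dec_energy : family_mean D l w (fun o x => u o x ^+ 2) <=
    1 - \sum_(0 <= i < j) step_size e1 i ^+ 2;
  dec_eq : forall o x,
    h o x = \sum_(0 <= i < sz) c i * pullback D s rest (b i) (m i) o x + u o x;
  dec_shift : forall o n x, `|shift_error D s rest sz c m b o n x| <= n%:R * err }.

Section Refinement.
Variables (e1 : R) (j : nat) (err err' : R).
Variables (Om : Type) (l : seq Om) (w : Om -> R) (s : Om -> nat -> A) (rest : Om -> sys).
Variables (h u : Om -> X -> R) (sz : nat) (c : nat -> R) (m : nat -> nat).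
Variables (b : nat -> Om -> X -> R) (a a' : nat).
Hypotheses (e10 : 0 < e1) (lw : weights l w) (rest1 : forall o, unit_sys D (rest o)).
Hypothesis dec : decomposition e1 j err l w s rest h u sz c m b.
Hypothesis aa' : (a < a')%N.
Hypothesis large : e1 <= family_mean D l w (fun o x => head_average D s rest u a a' o x ^+ 2).
Hypothesis err_le : err + 2 * step_size e1 j / (a' - a)%N%:R <= err'.

Local Notation B := (sup_bound e1 j).
Local Notation N := (a' - a)%N.
Local Notation sigma := (dual_function D s rest u a a' B).
Local Notation b0 := (scaled_average D s rest u a a' B).

(** The new dual function is appended as [a' - a] terms with equal coefficients, one for each [m] of
    the interval. *)
Let c' i := if (i < sz)%N then c i else step_size e1 j / N%:R.
Let m' i := if (i < sz)%N then m i else (a + (i - sz))%N.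
Let b' i := if (i < sz)%N then b i else b0.
Let u' o x := u o x - step_size e1 j * sigma o x.

Let N0 : 0 < N%:R :> R.
Proof. by rewrite ltr0n subn_gt0. Qed.

Let step_size_gt0 : 0 < step_size e1 j.
Proof. by rewrite divr_gt0 // sup_bound_gt0. Qed.

Let sumE (Phi : R -> nat -> (Om -> X -> R) -> R) :
  \sum_(0 <= i < sz + N) Phi (c' i) (m' i) (b' i) =
  \sum_(0 <= i < sz) Phi (c i) (m i) (b i) +
  \sum_(a <= i < a') Phi (step_size e1 j / N%:R) i b0.
Proof.
rewrite (@big_cat_nat _ _ _ sz) ?leq_addr //=; congr (_ + _).
  by apply: eq_big_nat => i /andP[_ isz]; rewrite /c' /m' /b' isz.
rewrite -{1}[sz]add0n big_addn addKn -[in RHS](add0n a) big_addn.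
by apply: eq_bigr => i _; rewrite /c' /m' /b' ltnNge leq_addl /= addnK addnC.
Qed.

(** The energy is handled by [energy_drop]. A shift by [n] changes the new mean by at most [2 * n]
    terms out of [a' - a], which is the increment allowed by [err_le]. *)
Lemma decomposition_refine :
  decomposition e1 j.+1 err' l w s rest h u' (sz + N) c' m' b'.
Proof.
have [w0 w1] := lw; have B0 := sup_bound_gt0 e10 j.
have ou := dec_u dec; have uB := dec_ub dec.
have ub0 o : unit_obs D (b0 o) by exact: unit_obs_scaled_average.
have us o : unit_obs D (sigma o) by exact: unit_obs_dual_function.
split.
- by move=> i; rewrite /c'; case: ifP => _; [exact: dec_c dec _|rewrite divr_ge0 ?ltW].
- by move=> i o; rewrite /b'; case: ifP => _; [exact: dec_b dec _ _|].
- rewrite (sumE (fun c _ _ => c)) big_nat_recr //=; apply: lerD; first exact: dec_sum dec.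
  rewrite sumr_const_nat -[_ *+ _]mulr_natr divfK //.
  by rewrite gt_eqF.
- by move=> o; apply: obsB => //; apply: obsZ; have [] := us o.
- move=> o x; apply: le_trans (ler_normB _ _) _; apply: lerD => //.
  rewrite normrM (gtr0_norm step_size_gt0) -[leRHS]mulr1 ler_wpM2l ?(ltW step_size_gt0) //.
  by have [_] := us o; apply.
- rewrite big_nat_recr //= opprD addrA.
  apply: le_trans (energy_drop w0 w1 rest1 B0 e10 ou uB large) _.
  by rewrite lerD2r; exact: dec_energy dec.
- move=> o x; rewrite (sumE (fun c m b => c * pullback D s rest b m o x)) (dec_eq dec).
  rewrite -addrA; congr (_ + _); rewrite /u' -mulr_sumr /dual_function /interval_average.
  by rewrite mulrA addrC subrK.
- move=> o n x; rewrite /shift_error.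
  rewrite (sumE (fun c m b => c * pullback D s rest b m o (act (s o n) x))).
  rewrite (sumE (fun c m b => c * pullback D s rest b (n + m) o (act (s o n) x))).
  rewrite opprD addrACA; apply: le_trans (ler_normD _ _) _.
  apply: (@le_trans _ _ (n%:R * err + n%:R * (2 * step_size e1 j / N%:R))); last first.
    by rewrite -mulrDr ler_wpM2l.
  apply: lerD; first exact: dec_shift dec _ _ _.
  rewrite -!mulr_sumr -mulrBr normrM gtr0_norm ?divr_gt0 //.
  have -> : n%:R * (2 * step_size e1 j / N%:R) = step_size e1 j / N%:R * (2 * n%:R) by ring.
  apply: ler_wpM2l; first exact: divr_ge0 (ltW step_size_gt0) (ltW N0).
  apply: (@norm_sum_shift_le _ (fun i => pullback D s rest b0 i o (act (s o n) x))
    _ _ n (ltnW aa')).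
  by move=> i; have [_] := unit_obs_pullback s rest1 i (ub0 o); apply.
Qed.

End Refinement.

Section Step.
Variable k : nat.
Hypothesis Hk : metastable D k.
Variables (e : R) (F : nat -> nat) (M0 : nat).
Hypothesis e0 : 0 < e.
Local Notation e1 := (e / 16).

(* The scales decrease along the stages: a window that fails at stage [j] provides
   a dual function over an interval so long that its [err] is admissible at the
   smaller scales of stage [j.+1]. *)
Definition descent (j : nat) : Prop := exists err K, 0 < err /\
  forall (Om : Type) (l : seq Om) (w : Om -> R) (s : Om -> nat -> A) (rest : Om -> sys) h,
  weights l w -> (forall o, unit_sys D (rest o)) ->
  (forall o m, complexity k
     (map fst (rest o) ++ map (twin (s o) m) (0 :: map fst (rest o)))) ->
  forall u sz c m b, decomposition e1 j err l w s rest h u sz c m b ->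
  exists2 M, (M0 <= M <= K)%N &
    stable_window D l w (head_average D s rest h) e M (F M).

(** The induction hypothesis on complexity gives a scale [M] at which all reduced lists are stable.
    If the averages of [u] are small there, so is the oscillation of the averages of [h]; otherwise
    an interval with a large average leads to stage [j.+1]. *)
Lemma descentS j : descent j.+1 -> descent j.
Proof.
move=> [err' [K' [err'0 IH]]].
have e10 : 0 < e1 by rewrite divr_gt0.
have step_gt0 i : 0 < step_size e1 i by rewrite divr_gt0 // sup_bound_gt0.
(* Bounds the total coefficient at stage [j] whatever the number of terms, so that [K1] below does
   not depend on the decomposition. *)
pose C : R := 1 + \sum_(0 <= i < j) step_size e1 i.
have sum0 : 0 <= \sum_(0 <= i < j) step_size e1 i by apply: sumr_ge0 => i _; exact: ltW.
have C1 : 1 <= C by rewrite lerDl.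
have C0 : 0 < C by exact: lt_le_trans C1.
pose del : R := Num.min 1 e / 8.
have del0 : 0 < del by rewrite divr_gt0 // lt_min ltr01.
have delE : del ^+ 2 <= e / 64.
  rewrite /del; have : Num.min 1 e <= 1 by rewrite ge_min lexx.
  have : Num.min 1 e <= e by rewrite ge_min lexx orbT.
  have : 0 < Num.min 1 e by rewrite lt_min ltr01.
  by move: (Num.min 1 e) => d; nra.
(* On intervals of length at least [M1], the shift cost [2 * step_size e1 j / (a' - a)] of the next
   dual function is at most [err' / 2]. *)
pose M1 := maxn M0 (Num.bound (4 * step_size e1 j / err')).
have q0 : 0 <= 4 * step_size e1 j / err'.
  exact: divr_ge0 (mulr_ge0 (ler0n _ 4) (ltW (step_gt0 j))) (ltW err'0).
have M1P : 4 * step_size e1 j / err' < M1%:R.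
  by apply: lt_le_trans (archi_boundP q0) _; rewrite ler_nat leq_maxr.
have M1p : 0 < M1%:R :> R by exact: le_lt_trans M1P.
have [|K1 HK1] := Hk (e := e / (16 * C ^+ 2)) F M1.
  by rewrite divr_gt0 // mulr_gt0 // exprn_gt0.
(* Exceeds [F M] for every [M <= K1]. The two parts of [err] below leave half of [err'] for the next
   stage and keep the shift errors up to time [F M] below [del]. *)
pose T := (\sum_(0 <= M < K1.+1) F M).+1.
pose err := Num.min (err' / 2) (del / T%:R).
have err0 : 0 < err by rewrite lt_min (divr_gt0 err'0) // (divr_gt0 del0) // ltr0n.
exists err, (maxn K1 K'); split=> // Om l w s rest h lw rest1 cx u sz c m b dec.
have [w0 w1] := lw.
have c0 := dec_c dec; have b1 := dec_b dec.
have cC : \sum_(0 <= i < sz) c i <= C.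
  by apply: le_trans (dec_sum dec) _; rewrite lerDr.
have [||oi|M /andP[M1M MK1] win] := HK1 _ [seq (o, i) | o <- l, i <- index_iota 0 sz]
     (fun oi => w oi.1 * (c oi.2 / C)) (fun oi => reduction s rest oi.1 (m oi.2) (b oi.2 oi.1)).
- split=> [oi|]; first by rewrite mulr_ge0 // divr_ge0 // ltW.
  rewrite big_allpairs /=; apply: le_trans w1; apply: ler_sum => o _.
  rewrite -mulr_sumr -mulr_suml ler_piMr //.
  by rewrite ler_pdivrMr // mul1r.
- move=> oi; have := cx oi.1 (m oi.2).
  by rewrite /reduction map_cat /= -!map_comp.
- exact: unit_sys_reduction.
have FMT : (F M)%:R * err <= del.
  apply: (@le_trans _ _ (T%:R * err)).
    rewrite ler_wpM2r ?(ltW err0) // ler_nat /T (bigD1_seq M) ?iota_uniq //=.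
      by rewrite leqW // leq_addr.
    by rewrite mem_index_iota ltnS.
  by rewrite mulrC -ler_pdivlMr // ge_min lexx orbT.
have M0M : (M0 <= M)%N by apply: leq_trans M1M; exact: leq_maxl.
have [small|/existsNP[a /existsNP[a' /not_implyP[a'F /not_implyP[aM /negP]]]]] :=
  pselect (forall a a', (a' <= F M)%N -> (a + M <= a')%N ->
     family_mean D l w (fun o x => head_average D s rest u a a' o x ^+ 2) <= e1).
  exists M; first by rewrite M0M leq_max MK1.
  move=> p p' q q' p'F q'F pM qM.
  have H := stable_window_step lw rest1 c0 b1 (dec_u dec) (dec_eq dec) C1 cC (ltW err0) FMT
    (dec_shift dec) win small p'F q'F pM qM.
  (* The contributions add up to [4 * (e / 16 + 4 * (e / 64) + 2 * (e / 16)) = e]. *)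
  apply: le_trans H _.
  have -> : C ^+ 2 * (e / (16 * C ^+ 2)) = e / 16 by field; rewrite gt_eqF.
  by move: delE; lra.
rewrite -ltNge => large.
have aa' : (a < a')%N.
  apply: leq_trans aM; rewrite -addn1 leq_add2l; apply: leq_trans M1M.
  by rewrite -(ltr_nat R).
have err_le : err + 2 * step_size e1 j / (a' - a)%N%:R <= err'.
  have H1 : err <= err' / 2 by rewrite ge_min lexx.
  suff : 2 * step_size e1 j / (a' - a)%N%:R <= err' / 2 by lra.
  rewrite ler_pdivrMr ?ltr0n ?subn_gt0 //.
  have : M1%:R <= (a' - a)%N%:R :> R.
    by rewrite ler_nat leq_subRL ?(ltnW aa') //; apply: leq_trans aM; rewrite leq_add2l.
  by move: M1P; rewrite ltr_pdivrMr //; nra.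
have dec' := decomposition_refine e10 lw rest1 dec aa' (ltW large) err_le.
have [M' /andP[M0M' M'K'] win'] := IH _ _ _ _ _ _ lw rest1 cx _ _ _ _ _ dec'.
by exists M' => //; rewrite M0M' leq_max M'K' orbT.
Qed.

(** At a stage [K] where the drops exceed [1] the energy would be negative: no decomposition exists
    and [descent] holds vacuously. [descentS] then leads back to stage [0]. *)
Lemma descent0 : descent 0.
Proof.
have e10 : 0 < e1 by rewrite divr_gt0.
have [K HK] := energy_unbounded e10.
suff H i : (i <= K)%N -> descent (K - i) by rewrite -(subnn K); exact: H.
elim: i => [_|i IH iK]; last first.
  by apply: descentS; rewrite subnSK //; apply: IH; exact: ltnW.
rewrite subn0; exists 1, 0%N; split=> // Om l w s rest h [w0 w1] _ _ u sz c m b dec.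
have : 0 <= family_mean D l w (fun o x => u o x ^+ 2).
  apply: family_mean_ge0 => // [q|q x]; last exact: sqr_ge0.
  exact/obsX2/(dec_u dec).
by have := dec_energy dec; move: HK; rewrite /step_size; lra.
Qed.

End Step.

(** Each list is rewritten with the head and tail provided by its complexity. The descent starts
    with no dual function and the head function itself as remainder. *)
Lemma metastableS k : metastable D k -> metastable D k.+1.
Proof.
move=> Hk e F M0 e0; have [err [K [err0 H]]] := descent0 Hk F M0 e0.
exists K => Om l w S lw cx S1.
have /choice[q qP] (o : Om) : exists q : (nat -> A) * (X -> R) * sys,
    [/\ unit_obs D q.1.2, unit_sys D q.2,
      forall m, complexity k
        (map fst q.2 ++ map (twin q.1.1 m) (0 :: map fst q.2)) &
      forall n x, orbit_prod D (S o) n x = q.1.2 (act (q.1.1 n) x) * orbit_prod D q.2 n x].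
  have [s [G [SG cxG]]] := cx o.
  have [[|[s' f] S'] [//]] := orbit_prod_absorb (S1 o) SG.
  move=> [-> GS'] /unit_sys_cons[f1 S'1] S'E; exists (s, f, S'); split=> //=.
  - by rewrite GS'.
  - by move=> n x; rewrite -S'E orbit_prod_cons.
pose s o := (q o).1.1; pose h o := (q o).1.2; pose rest o := (q o).2.
have rest1 o : unit_sys D (rest o) by have [] := qP o.
have h1 o : unit_obs D (h o) by have [] := qP o.
have dec : decomposition (e / 16) 0 err l w s rest h h 0 (fun=> 0) (fun=> 0%N) (fun _ _ _ => 1).
  split=> //.
  - by move=> _ _; exact: unit_obs1.
  - by rewrite !big_geq.
  - by move=> o; have [] := h1 o.
  - by move=> o x; have [_] := h1 o; apply.
  - rewrite big_geq // subr0; have [w0 w1] := lw.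
    apply: le_trans (family_mean_cst_le D w1 ler01).
    apply: family_mean_le => // [om|om|om x].
    + by apply: obsX2; have [] := h1 om.
    + exact: obs_cst.
    + have [_ /(_ x) hx1] := h1 om.
      by rewrite -(real_normK (num_real (h om x))) exprn_ile1.
  - by move=> o x; rewrite big_geq // add0r.
  - by move=> o n x; rewrite /shift_error !big_geq // subrr normr0 mulr_ge0 // ltW.
have [|M MK win] := H _ _ _ _ _ _ lw rest1 _ _ _ _ _ _ dec.
  by move=> o m; have [_ _ + _] := qP o; apply.
exists M => // a b a' b' bF b'F aM a'M.
have E o p p' x : interval_average (orbit_prod D (S o)) p p' x = head_average D s rest h p p' o x.
  by apply: eq_interval_average => n _; have [_ _ _ ->] := qP o.
rewrite (_ : family_mean _ _ _ _ = family_mean D l w (fun o x =>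
  (head_average D s rest h a b o x - head_average D s rest h a' b' o x) ^+ 2)).
  exact: win.
by apply: eq_family_mean => o x; rewrite !E.
Qed.

Lemma metastableP k : metastable D k.
Proof. by elim: k => [|k IH]; [exact: metastable0|exact: metastableS]. Qed.

(** Otherwise every scale [M] has a bad pair of intervals. Metastability of the single system, with
    [F M] at least the right endpoints of that pair, contradicts this. *)
Lemma uniform_cauchy k S (e : R) : complexity k (map fst S) -> unit_sys D S -> 0 < e ->
  exists M, forall a b a' b', (a + M <= b)%N -> (a' + M <= b')%N ->
    mean D (fun x => (interval_average (orbit_prod D S) a b x -
                     interval_average (orbit_prod D S) a' b' x) ^+ 2) <= e.
Proof.
move=> cx S1 e0; apply: contrapT => /forallNP H.
have {}H M : exists q : nat * nat * (nat * nat),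
    [/\ (q.1.1 + M <= q.1.2)%N, (q.2.1 + M <= q.2.2)%N &
     ~ mean D (fun x => (interval_average (orbit_prod D S) q.1.1 q.1.2 x -
        interval_average (orbit_prod D S) q.2.1 q.2.2 x) ^+ 2) <= e].
  have /existsNP[a /existsNP[b /existsNP[a' /existsNP[b']]]] := H M.
  by move=> /not_implyP[ab /not_implyP[a'b' N]]; exists ((a, b), (a', b')).
have [q qP] := choice H.
have [K HK] := @metastableP k e (fun M => maxn (q M).1.2 (q M).2.2) 0%N e0.
have [|_|_|M _ win] := HK unit [:: tt] (fun=> 1) (fun=> S) => //.
  by split=> //; rewrite big_seq1.
have [aM a'M []] := qP M.
have := win _ _ _ _ (leq_maxl _ _) (leq_maxr _ _) aM a'M.
by rewrite /family_mean big_seq1 mul1r.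
Qed.

End Descent.

(** * Powers of measure preserving maps *)

Section PolynomialDegree.

Lemma degree_lt_le (A : zmodType) j k (g : nat -> A) : (j <= k)%N ->
  degree_lt j g -> degree_lt k g.
Proof.
move=> /subnK <- gj; elim: (k - j)%N => // i IH.
by rewrite addSn; exact: degree_ltS.
Qed.

Lemma degree_lt_morph (A B : zmodType) (phi : A -> B) k (g : nat -> A) :
  {morph phi : x y / x - y} -> degree_lt k g -> degree_lt k (phi \o g).
Proof.
move=> phiB; elim: k g => /= [g ->|k IH g gk m].
  by apply/funext => n; have := phiB 0 0; rewrite !subrr.
have -> : (fun n => phi (g (n + m)%N) - phi (g n)) = phi \o (fun n => g (n + m)%N - g n).
  by apply/funext => n /=; rewrite phiB.
exact: IH.
Qed.

(** Discrete Leibniz rule: the difference of [g n * n] is the difference of [g] times [n], of degree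
    controlled by induction, plus [g (n + m) * m]. *)
Lemma degree_lt_mul k (g : nat -> int) :
  degree_lt k g -> degree_lt k.+1 (fun n => g n * n%:Z).
Proof.
elim: k g => [g -> m /=|k IH g gk m].
  by apply/funext => n /=; rewrite !mul0r subrr.
change (degree_lt k.+1 (fun n => g (n + m)%N * (n + m)%N%:Z - g n * n%:Z)).
rewrite [X in degree_lt _ X](_ : _ =
  (fun n => (g (n + m)%N - g n) * n%:Z) + ( *%R^~ m%:Z \o (fun n => g (n + m)%N))).
  apply: degree_ltD; first exact: IH (gk m).
  by apply: degree_lt_morph (degree_lt_shift _ gk) => x y; rewrite mulrBl.
by apply/funext => n; rewrite !fctE /= PoszD; ring.
Qed.

Lemma degree_lt_horner (p : {poly int}) : exists k, degree_lt k (fun n : nat => p.[n%:Z]).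
Proof.
elim/poly_ind: p => [|p c [k pk]].
  by exists 0%N => /=; apply/funext => n; rewrite horner0.
exists k.+1; rewrite (_ : (fun n : nat => _) = (fun n : nat => p.[n%:Z] * n%:Z) + (fun=> c)).
  apply: degree_ltD; first exact: degree_lt_mul.
  apply: (@degree_lt_le _ 1) => // m /=; apply/funext => n /=.
  by rewrite subrr.
by apply/funext => n; rewrite !fctE !hornerE.
Qed.

End PolynomialDegree.

Section IntegerIterates.
Variables (d : measure_display) (X : measurableType d) (R : realType).
Variable mu : probability X R.
Implicit Types (T : invertible_mp mu) (x : X).

Lemma iterz_succ T m x : iterz T (m + 1) x = T (iterz T m x).
Proof.
case: m => [k|[|k]]; [by rewrite /= addn1|by rewrite /= mp_invK|].
rewrite (_ : Negz k.+1 + 1 = Negz k); last by rewrite !NegzE; lia.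
by rewrite /= mp_invK.
Qed.

Lemma iterz_pred T m x : iterz T (m - 1) x = mp_inv T (iterz T m x).
Proof. by rewrite -{2}(subrK 1 m) iterz_succ mp_funK. Qed.

Lemma iterzD T m n x : iterz T (m + n) x = iterz T m (iterz T n x).
Proof.
elim/int_rect: m => [|m IH|m IH]; first by rewrite add0r.
  by rewrite -addn1 PoszD addrAC !iterz_succ IH.
rewrite -addn1 PoszD opprD addrAC !iterz_pred IH //.
Qed.

Lemma iterz_comm T (f : X -> X) : (forall x, f (T x) = T (f x)) ->
  forall m x, f (iterz T m x) = iterz T m (f x).
Proof.
move=> fT; have fI x : f (mp_inv T x) = mp_inv T (f x).
  by rewrite -{2}(mp_invK T x) fT mp_funK.
case=> k x; elim: k => [|k /= IH] //=; first by rewrite fT IH.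
by rewrite fI IH.
Qed.

Lemma measure_preserving_comp (S T : X -> X) : measure_preserving mu S ->
  measure_preserving mu T -> measure_preserving mu (S \o T).
Proof.
move=> [mS pS] [mT pT]; split=> [|A mA]; first exact: measurableT_comp.
rewrite comp_preimage pT ?pS //.
by rewrite -[X in measurable X]setTI; exact: mS.
Qed.

Lemma measure_preserving_id : measure_preserving mu id.
Proof. by split=> [|A mA]; first exact: measurable_id. Qed.

Lemma measure_preserving_inv T : measure_preserving mu (mp_inv T).
Proof.
have [mT pT] := mp_fun_preserving T.
split=> [|A mA]; first exact: mp_inv_measurable.
rewrite -pT; last by rewrite -[X in measurable X]setTI; exact: mp_inv_measurable.
by congr (mu _); rewrite -comp_preimage; apply/seteqP; split=> x /=; rewrite mp_funK.
Qed.

Lemma measure_preserving_iterz T m : measure_preserving mu (iterz T m).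
Proof.
have H (S : X -> X) k : measure_preserving mu S -> measure_preserving mu (iter k S).
  move=> pS; elim: k => [|k IH]; first exact: measure_preserving_id.
  exact: measure_preserving_comp.
by case: m => k; apply: H; [exact: mp_fun_preserving|exact: measure_preserving_inv].
Qed.

Section Action.
Variables (l : nat) (T : 'I_l -> invertible_mp mu).
Hypothesis T_comm : forall i j x, T i (T j x) = T j (T i x).

Definition zact (a : 'I_l -> int) (x : X) : X :=
  foldr (fun i y => iterz (T i) (a i) y) x (enum 'I_l).

Lemma iterz_iterz_comm i j m n x :
  iterz (T i) m (iterz (T j) n x) = iterz (T j) n (iterz (T i) m x).
Proof. by apply: iterz_comm => y; rewrite (iterz_comm (f := T j)). Qed.

Lemma zact0 x : zact 0 x = x.
Proof. by rewrite /zact; elim: (enum 'I_l) => //= i r ->. Qed.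

Lemma zactD a b x : zact (a + b) x = zact a (zact b x).
Proof.
rewrite /zact; elim: (enum 'I_l) => //= i r ->; rewrite !fctE iterzD; congr iterz.
move: (foldr _ x r) => y; elim: r => //= j r <-; exact: iterz_iterz_comm.
Qed.

Lemma zact_single i n x : zact (fun j => if j == i then n else 0) x = iterz (T i) n x.
Proof.
rewrite /zact; have : i \in enum 'I_l by rewrite mem_enum.
have := enum_uniq 'I_l; elim: (enum 'I_l) => //= j r IH /andP[jr ur].
rewrite in_cons => /orP[/eqP ij|ir]; last first.
  by rewrite IH //; case: eqP => // ji; rewrite ji ir in jr.
rewrite -ij eqxx; congr iterz; move: jr; rewrite -ij => ir.
elim: r ir {IH ur} => //= k r IH; rewrite in_cons negb_or => /andP[ik ir].
by rewrite eq_sym (negbTE ik) /= IH.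
Qed.

Lemma measure_preserving_zact a : measure_preserving mu (zact a).
Proof.
rewrite /zact; elim: (enum 'I_l) => [|i r IH]; first exact: measure_preserving_id.
exact: measure_preserving_comp (measure_preserving_iterz _ _) IH.
Qed.

End Action.

(** Bounded everywhere and not just almost everywhere, as [unit_obs] asks for pointwise bounds;
    functions in [L^oo] are clipped beforehand. *)
Definition bounded_mfun (f : X -> R) : Prop :=
  measurable_fun [set: X] f /\ exists B : R, forall x, `|f x| <= B.

Lemma bounded_mfun_integrable f : bounded_mfun f -> mu.-integrable [set: X] (EFin \o f).
Proof.
move=> [mf [B fB]]; apply: measurable_bounded_integrable => //.
  by rewrite (le_lt_trans (probability_le1 _ _)) // ltry.
exists B; split; first exact: num_real.
by move=> M BM x _ /=; exact: le_trans (fB x) (ltW BM).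
Qed.

Lemma bounded_mfun_cst c : bounded_mfun (fun=> c).
Proof. by split; [exact: measurable_cst|exists `|c|]. Qed.

Lemma bounded_mfunD f g : bounded_mfun f -> bounded_mfun g -> bounded_mfun (fun x => f x + g x).
Proof.
move=> [mf [B fB]] [mg [C gC]]; split; first exact: measurable_funD.
by exists (B + C) => x; rewrite (le_trans (ler_normD _ _)) // lerD.
Qed.

Lemma bounded_mfunM f g : bounded_mfun f -> bounded_mfun g -> bounded_mfun (fun x => f x * g x).
Proof.
move=> [mf [B fB]] [mg [C gC]]; split; first exact: measurable_funM.
by exists (B * C) => x; rewrite normrM ler_pM.
Qed.

Lemma bounded_mfun_comp S f : measurable_fun [set: X] S -> bounded_mfun f ->
  bounded_mfun (fun x => f (S x)).
Proof. by move=> mS [mf [B fB]]; split; [exact: measurableT_comp|exists B]. Qed.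

Lemma Rintegral_measure_preserving S f : measure_preserving mu S -> bounded_mfun f ->
  \int[mu]_x f (S x) = \int[mu]_x f x.
Proof.
move=> [mS pS] bf; have bfS := bounded_mfun_comp mS bf; rewrite /Rintegral; congr fine.
have -> : (\int[mu]_x (f x)%:E = \int[pushforward mu S]_x (f x)%:E)%E.
  by apply: eq_measure_integral => A mA _; exact: esym (pS _ mA).
rewrite integral_pushforward //.
  by apply/measurable_EFinP; have [] := bf.
exact: (bounded_mfun_integrable bfS).
Qed.

Lemma probability_Rintegral1 : \int[mu]_x (1 : R) = 1.
Proof.
rewrite Rintegral_cst // mul1r -[RHS]/(fine (1%:E : \bar R)); congr fine.
exact: probability_setT.
Qed.

Definition zdynamics (l : nat) (T : 'I_l -> invertible_mp mu)
    (T_comm : forall i j x, T i (T j x) = T j (T i x)) :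
  dynamics R ('I_l -> int) X.
Proof.
apply: (@Dynamics R ('I_l -> int) X (zact T) bounded_mfun (fun f => \int[mu]_x f x)).
- exact: zact0.
- exact: zactD.
- exact: bounded_mfun_cst.
- exact: bounded_mfunD.
- exact: bounded_mfunM.
- by move=> a f; apply: bounded_mfun_comp; have [] := measure_preserving_zact T a.
- exact: probability_Rintegral1.
- by move=> f g bf bg; apply: RintegralD => //; exact: bounded_mfun_integrable.
- by move=> c f bf; apply: RintegralZl => //; exact: bounded_mfun_integrable.
- move=> f g bf bg fg; apply: le_Rintegral => //; exact: bounded_mfun_integrable.
- by move=> a f; apply: Rintegral_measure_preserving; exact: measure_preserving_zact.
Defined.

End IntegerIterates.

(** * Limits in mean square *)

Section Clip.
Variable R : realType.

Definition clip (t : R) : R := Num.max (- 1) (Num.min 1 t).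

Lemma norm_clip t : `|clip t| <= 1.
Proof.
rewrite /clip ler_norml le_max lexx /= ge_max ge_min lexx /= andbT.
by rewrite (le_trans _ ler01) // oppr_le0.
Qed.

Lemma clip_id t : `|t| <= 1 -> clip t = t.
Proof. by rewrite ler_norml /clip => /andP[t1 t2]; rewrite (min_idPr t2) (max_idPr t1). Qed.

Lemma measurable_clip d (X : measurableType d) (f : X -> R) :
  measurable_fun [set: X] f -> measurable_fun [set: X] (fun x => clip (f x)).
Proof.
move=> mf; apply: (measurable_maxr (f := fun=> -1)); first exact: measurable_cst.
by apply: (measurable_minr (f := fun=> 1)) => //; exact: measurable_cst.
Qed.

End Clip.

Section L2Limit.
Variables (d : measure_display) (X : measurableType d) (R : realType).
Variable mu : probability X R.
Implicit Types f g : X -> R.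

Lemma bounded_mfunB f g : bounded_mfun f -> bounded_mfun g -> bounded_mfun (fun x => f x - g x).
Proof.
move=> bf bg; have := bounded_mfunD bf (bounded_mfunM (bounded_mfun_cst _ (-1)) bg).
by congr bounded_mfun; apply/funext => x; rewrite mulN1r.
Qed.

Lemma bounded_mfunX2 f : bounded_mfun f -> bounded_mfun (fun x => f x ^+ 2).
Proof. by move=> bf; apply: bounded_mfunM. Qed.

Lemma bounded_mfun_norm f : bounded_mfun f -> bounded_mfun (fun x => `|f x|).
Proof.
move=> [mf [B fB]]; split; first exact: measurableT_comp.
by exists B => x; rewrite normr_id.
Qed.

Lemma integral_EFin_bounded f : bounded_mfun f ->
  (\int[mu]_x (f x)%:E)%E = (\int[mu]_x f x)%:E.
Proof.
by move=> bf; rewrite /Rintegral fineK //; exact: integrable_fin_num (bounded_mfun_integrable mu bf).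
Qed.

Lemma Rintegral_bounded_le f g : bounded_mfun f -> bounded_mfun g ->
  (forall x, f x <= g x) -> \int[mu]_x f x <= \int[mu]_x g x.
Proof. by move=> bf bg fg; apply: le_Rintegral => //; exact: bounded_mfun_integrable. Qed.

Lemma Rintegral_sqr_split f g h : bounded_mfun f -> bounded_mfun g -> bounded_mfun h ->
  \int[mu]_x (f x - h x) ^+ 2 <=
  2 * \int[mu]_x (f x - g x) ^+ 2 + 2 * \int[mu]_x (g x - h x) ^+ 2.
Proof.
move=> bf bg bh.
have b1 : bounded_mfun (fun x => (f x - g x) ^+ 2) by exact/bounded_mfunX2/bounded_mfunB.
have b2 : bounded_mfun (fun x => (g x - h x) ^+ 2) by exact/bounded_mfunX2/bounded_mfunB.
have c1 := bounded_mfunM (bounded_mfun_cst _ 2) b1.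
have c2 := bounded_mfunM (bounded_mfun_cst _ 2) b2.
rewrite -!RintegralZl //; do ?exact: bounded_mfun_integrable.
rewrite -RintegralD //; do ?exact: bounded_mfun_integrable.
apply: Rintegral_bounded_le => [||x]; first exact/bounded_mfunX2/bounded_mfunB.
  exact: bounded_mfunD.
by have := sqr_ge0 ((f x - g x) - (g x - h x)); lra.
Qed.

Lemma cvgn_of_summable_increments (u : nat -> R) :
  (\sum_(0 <= k <oo) (`|u k.+1 - u k|)%:E < +oo)%E -> cvgn u.
Proof.
move=> ufin.
have S0 : (0 <= \sum_(0 <= k <oo) (`|u k.+1 - u k|)%:E)%E by exact: nneseries_ge0.
have : cvgn [normed series (fun k => u k.+1 - u k)].
  apply: nondecreasing_is_cvgn.
    by apply: nondecreasing_series => n _ _ /=.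
  exists (fine (\sum_(0 <= k <oo) (`|u k.+1 - u k|)%:E)%E) => _ [n _ <-].
  rewrite -lee_fin fineK ?ge0_fin_numE // /series /= -sumEFin.
  exact: nneseries_lim_ge.
move=> /normed_cvg cs.
have -> : u = (fun n => series (fun k => u k.+1 - u k) n + u 0%N).
  by apply/funext => n; rewrite /series /= telescope_sumr // subrK.
by apply: is_cvgD => //; exact: is_cvg_cst.
Qed.

Section Limit.
Variable v : nat -> X -> R.
Hypothesis mv : forall n, measurable_fun [set: X] (v n).
Hypothesis v1 : forall n x, `|v n x| <= 1.
Hypothesis cauchy : forall e, 0 < e -> exists K, forall m n, (K <= m)%N -> (K <= n)%N ->
  \int[mu]_x (v m x - v n x) ^+ 2 <= e.

Let bv n : bounded_mfun (v n).
Proof. by split=> //; exists 1. Qed.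

Lemma fast_subsequence : exists phi : nat -> nat, (forall N, exists K, forall k, (K <= k)%N -> (N <= phi k)%N) /\
  forall k, \int[mu]_x `|v (phi k.+1) x - v (phi k) x| <= (2^-1) ^+ k.
Proof.
have /choice[K KP] k : exists K, forall m n, (K <= m)%N -> (K <= n)%N ->
    \int[mu]_x (v m x - v n x) ^+ 2 <= (4^-1) ^+ k.
  by apply: cauchy; rewrite exprn_gt0 // invr_gt0.
(* The sum makes [phi] monotone and at least [K k], the summand [k] makes it tend to infinity. *)
pose phi k := (k + \sum_(0 <= i < k.+1) K i)%N.
have phiK k : (K k <= phi k)%N.
  by rewrite /phi big_nat_recr //= addnA leq_addl.
have phiS k : (phi k <= phi k.+1)%N.
  by rewrite /phi [X in (_ <= _ + X)%N]big_nat_recr //= leq_add // leq_addr.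
exists phi; split=> [N|k]; first by exists N => k Nk; rewrite (leq_trans Nk) // leq_addr.
have := KP k _ _ (leq_trans (phiK k) (phiS k)) (phiK k).
move: (phi k.+1) (phi k) => m n mn.
have bmn : bounded_mfun (fun x => v m x - v n x) by exact: bounded_mfunB.
(* For [y >= 0], [y <= t / 2 * y ^+ 2 + (2 * t)^-1]. With [t = 2 ^+ k] and a mean square of at most
   [4 ^- k], both terms contribute half of [2 ^- k]. *)
pose t : R := 2 ^+ k; have t0 : 0 < t by rewrite exprn_gt0.
have b1 := bounded_mfunM (bounded_mfun_cst _ (t / 2)) (bounded_mfunX2 bmn).
apply: (@le_trans _ _ (\int[mu]_x (t / 2 * (v m x - v n x) ^+ 2 + (2 * t)^-1))).
  apply: Rintegral_bounded_le => [||x]; first exact: bounded_mfun_norm.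
    exact: bounded_mfunD b1 (bounded_mfun_cst _ _).
  rewrite -real_normK ?num_real //; move: `|_| (normr_ge0 (v m x - v n x)) => y y0.
  rewrite -subr_ge0.
  have -> : t / 2 * y ^+ 2 + (2 * t)^-1 - y = (t * y - 1) ^+ 2 / (2 * t).
    by field; rewrite gt_eqF.
  by rewrite divr_ge0 ?sqr_ge0 // mulr_ge0 // ltW.
rewrite RintegralD //; last 2 first.
- exact: bounded_mfun_integrable b1.
- exact: bounded_mfun_integrable (bounded_mfun_cst _ _).
rewrite RintegralZl //; last exact: bounded_mfun_integrable (bounded_mfunX2 bmn).
have -> : \int[mu]_x (2 * t)^-1 = (2 * t)^-1.
  rewrite -[RHS]mulr1 -(probability_Rintegral1 mu) -RintegralZl //; last first.
    exact: bounded_mfun_integrable (bounded_mfun_cst _ _).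
  by under [RHS]eq_Rintegral do rewrite mulr1.
have mn' : \int[mu]_x (v m x - v n x) ^+ 2 <= (t ^+ 2)^-1.
  apply: le_trans mn _; rewrite exprVn /t -exprM mulnC exprM.
  by rewrite (_ : 2 ^+ 2 = 4 :> R) // expr2; lra.
have -> : 2^-1 ^+ k = t / 2 * (t ^+ 2)^-1 + (2 * t)^-1.
  by rewrite exprVn -/t; field; rewrite gt_eqF.
by rewrite lerD2r ler_wpM2l // divr_ge0 // ltW.
Qed.

(** As in the Riesz-Fischer theorem, a subsequence with summable increments converges almost
    everywhere. Dominated convergence gives convergence in [L^1], the uniform bound upgrades it to
    [L^2], and the Cauchy property extends it to the whole sequence. *)
Lemma bounded_L2_limit : exists L : X -> R,
  [/\ measurable_fun [set: X] L, forall x, `|L x| <= 1 &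
    forall e, 0 < e -> exists K, forall n, (K <= n)%N -> \int[mu]_x (v n x - L x) ^+ 2 <= e].
Proof.
have [phi [phi_oo phiP]] := fast_subsequence.
pose u k := v (phi k).
have bu k : bounded_mfun (u k) by exact: bv.
have bd k : bounded_mfun (fun x => `|u k.+1 x - u k x|).
  exact/bounded_mfun_norm/bounded_mfunB.
have md k : measurable_fun [set: X] (fun x => (`|u k.+1 x - u k x|)%:E).
  by apply/measurable_EFinP; have [] := bd k.
have ae_cvg : \forall x \ae mu, cvgn (u^~ x).
  have itg : mu.-integrable [set: X] (fun x => \sum_(0 <= k <oo) (`|u k.+1 x - u k x|)%:E)%E.
    apply/integrableP; split.
      by apply: ge0_emeasurable_sum => // k x _ _; rewrite lee_fin.
    under eq_integral => x _ do rewrite gee0_abs ?nneseries_ge0 //.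
    rewrite integral_nneseries //.
    apply: (@le_lt_trans _ _ (\sum_(0 <= k <oo) ((2^-1 : R) ^+ k)%:E)%E).
      apply: lee_nneseries => k _; first by rewrite integral_ge0 // => x _; rewrite lee_fin.
      by rewrite integral_EFin_bounded // lee_fin; exact: phiP.
    apply: (@le_lt_trans _ _ 2%:E); last by rewrite ltry.
    apply: lime_le; first by apply: is_cvg_nneseries => k _ _; rewrite lee_fin exprn_ge0 // invr_ge0.
    apply: nearW => n; rewrite sumEFin lee_fin.
    suff -> : \sum_(0 <= k < n) (2^-1 : R) ^+ k = 2 - 2 * 2^-1 ^+ n.
      by rewrite gerBl mulr_ge0 // exprn_ge0 // invr_ge0.
    elim: n => [|n IH]; first by rewrite big_geq // expr0 mulr1 subrr.
    by rewrite big_nat_recr //= IH exprS; lra.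
  have := integrable_ae measurableT itg.
  apply: filterS => x /(_ I) sfin; apply: cvgn_of_summable_increments.
  by rewrite ltey_eq sfin.
(* The upper limit is measurable and has a value also where the sequence diverges; clipping bounds
   it everywhere and changes nothing where the sequence converges. *)
pose L x := clip (limn_sup (u^~ x)).
have mL : measurable_fun [set: X] L.
  apply: measurable_clip; apply: measurable_fun_limn_sup => [x _|x _|n].
  - by exists 1 => _ [n _ <-]; have := v1 (phi n) x; rewrite ler_norml => /andP[].
  - by exists (- 1) => _ [n _ <-]; have := v1 (phi n) x; rewrite ler_norml => /andP[].
  - exact: mv.
have L1 x : `|L x| <= 1 by exact: norm_clip.
have bL : bounded_mfun L by split=> //; exists 1.
exists L; split=> // e e0.
have [|||||_ cv _] := @dominated_convergence _ _ _ mu [set: X] measurableT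
  (fun k x => (u k x)%:E) (fun x => (L x)%:E) (cst 1%:E).
- by move=> n; apply/measurable_EFinP; exact: mv.
- exact/measurable_EFinP.
- apply: filterS ae_cvg => x cu _; apply/fine_cvgP; split; first exact: nearW.
  have [_ lsup] := cvg_limn_inf_sup cu.
  rewrite /L [limn_sup _]lsup clip_id //.
  rewrite ler_norml; apply/andP; split.
    by apply: limr_ge => //; apply: nearW => n; have := v1 (phi n) x; rewrite ler_norml => /andP[].
  by apply: limr_le => //; apply: nearW => n; have := v1 (phi n) x; rewrite ler_norml => /andP[].
- exact: bounded_mfun_integrable (bounded_mfun_cst _ 1).
- by apply: nearW => x n _ /=; rewrite lee_fin; exact: v1.
(* The final count is [2 * (e / 4) + 2 * (2 * (e / 8)) = e]; the inner [2] bounds the distance of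
   two functions with values in [[-1, 1]]. *)
have [K _ KP] : \forall k \near \oo, \int[mu]_x `|u k x - L x| <= e / 8.
  move/fine_cvgP : cv => [_ /cvgrPdist_le /(_ (e / 8))].
  have e80 : 0 < e / 8 by rewrite divr_gt0.
  move=> /(_ e80); apply: filterS => k; rewrite sub0r normrN.
  exact: le_trans (ler_norm _).
have [|K2 K2P] := cauchy (e := e / 4); first by rewrite divr_gt0.
have [K3 K3P] := phi_oo K2.
exists K2 => n K2n; pose k := maxn K K3.
have buL : bounded_mfun (fun x => u k x - L x) by exact: bounded_mfunB.
apply: le_trans (Rintegral_sqr_split (bv n) (bu k) bL) _.
have H1 := K2P n (phi k) K2n (K3P _ (leq_maxr _ _)).
have H2 := KP k (leq_maxl _ _).
have H3 : \int[mu]_x (u k x - L x) ^+ 2 <= 2 * \int[mu]_x `|u k x - L x|.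
  rewrite -RintegralZl //; last exact: bounded_mfun_integrable (bounded_mfun_norm buL).
  apply: Rintegral_bounded_le => [||x]; first exact: bounded_mfunX2.
    exact: bounded_mfunM (bounded_mfun_cst _ _) (bounded_mfun_norm buL).
  rewrite -real_normK ?num_real // expr2 ler_wpM2r //.
  by apply: le_trans (ler_normB _ _) _; have := v1 (phi k) x; have := L1 x; rewrite /u; lra.
move: H1 H2 H3; rewrite -/(u k) /=; lra.
Qed.

End Limit.
End L2Limit.

(** * From bounded functions to [L^oo], and the theorem *)

Section Final.
Variables (d : measure_display) (X : measurableType d) (R : realType).
Variable mu : probability X R.

Lemma ae_measure_preserving (S : X -> X) (P : set X) : measure_preserving mu S ->
  (\forall x \ae mu, P x) -> \forall x \ae mu, P (S x).
Proof.
move=> [mS pS] [B [mB B0 PB]]; exists (S @^-1` B); split.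
- by rewrite -[X in measurable X]setTI; exact: mS.
- by rewrite -B0; exact: pS.
- by move=> x /= nP; apply: PB.
Qed.

Lemma Lfun_oo_clip (f : X -> R) : f \in Lfun mu +oo%E ->
  measurable_fun [set: X] f /\
  exists2 C : R, 0 < C & \forall x \ae mu, f x = C * clip (C^-1 * f x).
Proof.
case/andP; rewrite !inE /= => mf; rewrite /finite_norm unlock /=.
have -> : (0 < mu [set: X])%E by rewrite [X in (_ < X)%E](probability_setT mu) lte01.
move=> fin; split=> //.
have [C fC] := ess_supr_bounded (f := Num.norm \o f) fin.
(* The maximum with [1] makes the scaling constant positive, also when the essential bound is
   [0]. *)
exists (Num.max 1 C); first by rewrite lt_max ltr01.
apply: filterS fC => x /= fxC.
have C0 : 0 < Num.max 1 C by rewrite lt_max ltr01.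
rewrite clip_id; first by rewrite mulrA mulfV ?mul1r // gt_eqF.
rewrite normrM normfV (gtr0_norm C0) ler_pdivrMl // mulr1.
by rewrite le_max fxC orbT.
Qed.

Lemma Lnorm2_bounded (g : X -> R) : bounded_mfun g ->
  Lnorm mu 2%:E (EFin \o g) = (Num.sqrt (\int[mu]_x g x ^+ 2))%:E.
Proof.
move=> bg; rewrite unlock /=.
under eq_integral => x _.
  rewrite powR_mulrn // real_normK ?num_real //.
  over.
rewrite integral_EFin_bounded; last exact: bounded_mfunX2.
rewrite poweR_EFin powR12_sqrt //.
by apply: Rintegral_ge0 => // x _; exact: sqr_ge0.
Qed.

Lemma bounded_mfun_Lfun2 (g : X -> R) : bounded_mfun g -> g \in Lfun mu 2%:E.
Proof.
move=> bg; apply/andP; split; rewrite inE /=; first by have [] := bg.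
by rewrite /finite_norm Lnorm2_bounded // ltry.
Qed.

Lemma eq_ae_Lnorm2 (f g : X -> R) : measurable_fun [set: X] f ->
  measurable_fun [set: X] g -> (\forall x \ae mu, f x = g x) ->
  Lnorm mu 2%:E (EFin \o f) = Lnorm mu 2%:E (EFin \o g).
Proof.
move=> mf mg fg; rewrite unlock /=; congr (_ `^ _)%E.
have m2 (h : X -> R) : measurable_fun [set: X] h ->
    measurable_fun [set: X] (fun x => (`|h x| `^ 2)%:E).
  move=> mh; apply/measurable_EFinP.
  rewrite (_ : (fun x => `|h x| `^ 2) = fun x => h x * h x); first exact: measurable_funM.
  by apply/funext => x; rewrite powR_mulrn // real_normK ?num_real.
apply: ae_eq_integral => //; [exact: m2|exact: m2|].
by apply: filterS fg => x fgx _; rewrite /= fgx.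
Qed.

(** Transfers convergence from the normalized functions to the given ones: outside one null set
    common to all [n], the two averages differ by the factor [C] only. *)
Lemma uniform_average_cvg_L2_scale (a b : nat -> X -> R) (C : R) (L : X -> R) : 0 < C ->
  (forall n, measurable_fun [set: X] (a n)) -> (forall n, bounded_mfun (b n)) ->
  bounded_mfun L -> (\forall x \ae mu, forall n, a n x = C * b n x) ->
  (forall e, 0 < e -> exists K, forall M N, (M + K <= N)%N ->
     \int[mu]_x (interval_average b M N x - L x) ^+ 2 <= e) ->
  uniform_average_cvg_L2 mu a (fun x => C * L x).
Proof.
move=> C0 ma bb bL ab H M N M0 MN.
have bav p q : bounded_mfun (interval_average b p q).
  apply: bounded_mfunM (bounded_mfun_cst _ _) _.
  elim: (index_iota p q) => [|n r IH].
    by under eq_fun do rewrite big_nil; exact: bounded_mfun_cst.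
  by under eq_fun do rewrite big_cons; exact: bounded_mfunD.
have bdiff p q : bounded_mfun (fun x => interval_average b p q x - L x) by exact: bounded_mfunB.
have bdiffC p q : bounded_mfun (fun x => C * (interval_average b p q x - L x)).
  exact: bounded_mfunM (bounded_mfun_cst _ _) (bdiff _ _).
have E k : Lnorm mu 2%:E (EFin \o (interval_average a (M k) (N k) \- (fun x => C * L x))) =
   (C * Num.sqrt (\int[mu]_x (interval_average b (M k) (N k) x - L x) ^+ 2))%:E.
  rewrite (@eq_ae_Lnorm2 _ (fun x => C * (interval_average b (M k) (N k) x - L x))).
  - rewrite Lnorm2_bounded //; congr EFin.
    under eq_Rintegral do rewrite exprMn.
    rewrite RintegralZl //; last exact/bounded_mfun_integrable/bounded_mfunX2.
    by rewrite sqrtrM ?sqr_ge0 // sqrtr_sqr gtr0_norm.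
  - apply: measurable_funB; last by apply: measurable_funM => //; have [] := bL.
    by apply: measurable_funM => //; exact: measurable_sum.
  - by have [] := bdiffC (M k) (N k).
  - apply: filterS ab => x abx /=; rewrite mulrBr; congr (_ - _).
    by rewrite -interval_averageZ; apply: eq_interval_average => n _.
apply/fine_cvgP; split; first by apply: nearW => k; rewrite E.
apply/cvgrPdist_le => e e0; have [|K KP] := H ((e / C) ^+ 2).
  by rewrite exprn_gt0 // divr_gt0.
(* A truncated difference of at least [1] forces [M k < N k], so that it is a true length. *)
have /cvgnyPge/(_ (maxn 1 K)) := MN; apply: filterS => k; rewrite geq_max => /andP[k1 kK].
rewrite /= E /= sub0r normrN ger0_norm ?mulr_ge0 ?sqrtr_ge0 ?(ltW C0) //.
rewrite mulrC -ler_pdivlMr // -[leRHS]ger0_norm; last by rewrite divr_ge0 ?ltW.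
rewrite -sqrtr_sqr ler_wsqrtr //; apply: KP.
by rewrite -leq_subRL //; move: k1; rewrite subn_gt0 => /ltnW.
Qed.

End Final.

Theorem theorem1p1 (d : measure_display) (X : measurableType d) (R : realType)
    (mu : probability X R) (l : nat) (l_gt0 : (0 < l)%N)
    (T : 'I_l -> invertible_mp mu)
    (T_comm : forall (i j : 'I_l) (x : X), T i (T j x) = T j (T i x))
    (f : 'I_l -> X -> R) (f_Loo : forall i : 'I_l, f i \in Lfun mu +oo%E)
    (p : 'I_l -> {poly int})
    (p_deg : forall i j : 'I_l, i <> j -> size (p i) <> size (p j)) :
  exists2 L : X -> R, L \in Lfun mu (2%:E)%E &
    uniform_average_cvg_L2 mu
      (fun n x => \prod_(i < l) f i (iterz (T i) (p i).[n%:Z] x)) L.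
Proof.
have mf i : measurable_fun [set: X] (f i) by have [] := Lfun_oo_clip (f_Loo i).
have /choice[C CP] i : exists C : R, 0 < C /\
    \forall x \ae mu, f i x = C * clip (C^-1 * f i x).
  by have [_ [C C0 fC]] := Lfun_oo_clip (f_Loo i); exists C.
pose h i x := clip ((C i)^-1 * f i x).
have mh i : measurable_fun [set: X] (h i).
  by apply: measurable_clip; apply: measurable_funM.
pose D := zdynamics T_comm.
(* Each polynomial runs along its own coordinate of [Z^l], so that one action carries all the
   maps. *)
pose g i : nat -> 'I_l -> int := fun n j => if j == i then (p i).[n%:Z] else 0.
pose S := [seq (g i, h i) | i <- enum 'I_l].
have S1 : unit_sys D S.
  move=> _ /mapP[i _ ->] /=; split=> [|x]; last exact: norm_clip.
  by split=> //; exists 1 => x; exact: norm_clip.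
have SE n x : orbit_prod D S n x = \prod_(i < l) h i (iterz (T i) (p i).[n%:Z] x).
  by rewrite /orbit_prod big_map big_enum; apply: eq_bigr => i _; rewrite /= zact_single.
have [k cxS] : exists k, complexity k (map fst S).
  have /choice[kd kdP] i : exists k, degree_lt k (g i).
    have [k pk] := degree_lt_horner (p i); exists k.
    apply: (degree_lt_morph (phi := fun z (j : 'I_l) => if j == i then z else 0)) pk.
    by move=> y z; apply/funext => j; rewrite !fctE; case: ifP; rewrite ?subr0.
  have [kap H] := complexity_bounded_degree ('I_l -> int) (\sum_i kd i).
  exists (kap (size (map fst S))); apply: H => _ /mapP[_ /mapP[i _ ->] ->] /=.
  by apply: degree_lt_le (kdP i); rewrite (bigD1 i) //= leq_addr.
have bS n : bounded_mfun (orbit_prod D S n) by have [] := unit_obs_orbit_prod n S1.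
have bav a b : bounded_mfun (interval_average (orbit_prod D S) a b).
  exact: (@obs_interval_average _ _ _ D).
have av1 a b x : `|interval_average (orbit_prod D S) a b x| <= 1.
  apply: interval_average_norm_le => // n _.
  by have [_] := unit_obs_orbit_prod n S1; apply.
(* The candidate limit comes from the averages over [[0, n)]; all other long intervals are compared
   with these at the end. *)
have [|||L [mL L1 LP]] := @bounded_L2_limit _ _ _ mu
    (fun n => interval_average (orbit_prod D S) 0 n).
- by move=> n; have [] := bav 0%N n.
- by move=> n x; exact: av1.
- move=> e e0; have [M MP] := uniform_cauchy cxS S1 e0; exists M => m n Mm Mn.
  by apply: MP.
have bL : bounded_mfun L by split=> //; exists 1.
have C0 : 0 < \prod_i C i by apply: prodr_gt0 => i _; have [] := CP i.
exists (fun x => (\prod_i C i) * L x).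
  exact/bounded_mfun_Lfun2/(bounded_mfunM (bounded_mfun_cst _ _)).
apply: (@uniform_average_cvg_L2_scale _ _ _ mu _ (orbit_prod D S)) => //.
- move=> n; apply: measurable_prod => i _; apply: measurableT_comp => //.
  by have [] := measure_preserving_iterz (T i) (p i).[n%:Z].
(* Countably many null sets, one for each [n] and [i], are pulled back along the measure preserving
   iterates and united. *)
- apply: ae_foralln => n.
  have : \forall x \ae mu, forall i, f i (iterz (T i) (p i).[n%:Z] x) =
      C i * h i (iterz (T i) (p i).[n%:Z] x).
    apply: filter_forall => i; have [_] := CP i.
    exact: ae_measure_preserving (measure_preserving_iterz _ _).
  apply: filterS => x fx; rewrite SE -big_split; apply: eq_bigr => i _; exact: fx.
- move=> e e0; have e4 : 0 < e / 4 by rewrite divr_gt0.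
  have [M MP] := uniform_cauchy cxS S1 e4; have [K KP] := LP _ e4.
  exists M => a b ab; pose n := maxn M K.
  apply: le_trans (Rintegral_sqr_split mu (bav a b) (bav 0%N n) bL) _.
  have H1 := MP a b 0%N n ab (leq_maxl _ _); have H2 := KP n (leq_maxr _ _).
  by move: H1 H2; rewrite /=; lra.
Qed.
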